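(* Let $N\ge 1$, $T>0$, $p\in(0,1)$, $r=(r_1,\dots,r_N)\in(0,1)^N$, and let $\mathcal G=(\mathcal V,\mathcal E)$ be a rooted simple digraph on $\mathcal V=\{1,\dots,N\}$. Then $(p,r,\mathcal G)$ is a sync-triplet. Moreover, for every initial condition $\pmb\tau_\omega(0,0)\in[0,1]^N$, every random solution $\pmb\tau_\omega$ of the stochastic hybrid system $\mathcal H_S(p,r,\mathcal G)$ from that initial condition, and every positive integer $n$, $$\mathbb P\big(\pmb T^*(\pmb\tau_\omega)>nT^*\big)\le \rho^n,$$ where $T^*:=(\operatorname{dep}(\mathcal G)\,\ell^*+1)\,T$, $\ell^*:=N(\lfloor 1/\underline r\rfloor+1)$ with $\underline r:=\min_i r_i$, and $$\rho:=1-\big(p\,(1-p)^{\operatorname{dep}(\mathcal G)-1}\big)^{N\ell^*}\in(0,1).$$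
   Context: Graphs: $\mathcal G=(\mathcal V,\mathcal E)$ is a simple digraph (no self-loops); $(i,j)\in\mathcal E$ means $j$ is an out-neighbor of $i$; $\mathcal E_i^-$ is the set of out-edges of $i$. A path is a sequence of pairwise distinct vertices with consecutive pairs in $\mathcal E$; its length is its number of edges. A vertex $i$ is a root if every other vertex is reachable from $i$ by a path; $\mathcal G$ is rooted if it has a root; $\mathcal V_R$ is the set of roots. For a root $i^*$, the depth of $j$ is the length of a shortest path from $i^*$ to $j$, and $q^*(i^* )$ is the maximal depth; $\operatorname{dep}(\mathcal G):=\max_{i^*\in\mathcal V_R}q^*(i^* )$. Random feasible subgraphs: a subgraph $(\mathcal V,\mathcal E')$, $\mathcal E'\subseteq\mathcal E$, is feasible if for each $i$ either $\mathcal E_i^-\subseteq\mathcal E'$ or $\mathcal E_i^-\cap\mathcal E'=\varnothing$. Let $\mathcal V^*$ be the set of vertices with at least one out-neighbor, $N^*=|\mathcal V^*|$. Feasible subgraphs correspond bijectively to $v=(v_i)_{i\in\mathcal V^*}\in\{0,1\}^{N^*}$ via $v_i=1$ iff $\mathcal E_i^-\subseteq\mathcal E'$. Let $\mu$ be the law on feasible subgraphs obtained by taking the $v_i$ i.i.d. Bernoulli$(p)$, i.e. $\mu(\phi)=p^{N'}(1-p)^{N^*-N'}$ with $N'$ the number of ones in $v$. Let $\omega=\omega_1\omega_2\cdots$ be an i.i.d. sequence with $\omega_k\sim\mu$ on a probability space $(\Omega,\mathcal F,\mathbb P)$. Stochastic hybrid system $\mathcal H_S(p,r,\mathcal G)$: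 state $\tau\in\mathbb R^N$; flow set $C_\tau=[0,1]^N$ with $\dot\tau=\frac1T\mathbf 1_N$; jump set $D_\tau=\{\tau\in[0,1]^N:\max_i\tau_i=1\}$ with $\tau^+\in G_S(\tau,\omega_{k+1})$ at the $(k+1)$-st jump. Here, with $\mathcal R_j(s)=\{0\}$ for $s\in[0,r_j)$, $\{0,1\}$ for $s=r_j$, $\{1\}$ for $s\in(r_j,1]$, and $\bar{\mathcal R}_j$ its outer-semicontinuous hull, set $S_{ij}(\tau_j,v)=v_i\bar{\mathcal R}_j(\tau_j)+(1-v_i)\tau_j$; $G^0_S(\tau,v)=\{g\in\mathbb R^N: g_i=0,\ g_j\in S_{ij}(\tau_j,v)\text{ if }(i,j)\in\mathcal E,\ g_j=\tau_j\text{ if }(i,j)\notin\mathcal E,\ j\ne i\}$, defined (nonempty) only when $\tau_i=1$ for some $i$ and $\tau_j\in[0,1)$ for $j\ne i$; and $G_S(\tau,v)$ is the outer-semicontinuous hull of $G_S^0(\cdot,v)$ (the map whose graph is the closure of the graph of $G_S^0(\cdot,v)$). Hybrid solutions: a hybrid time domain is $E\subset\mathbb R_{\ge0}\times\mathbb Z_{\ge0}$ whose truncations are of the form $\bigcup_k[t_k,t_{k+1}]\times\{k\}$ with $0=t_0\le t_1\le\cdots$; a hybrid arc is a function on such a domain, locally absolutely continuous in $t$ for each fixed $k$. A random solution $\pmb\tau_\omega$ is a map from $\Omega$ to hybrid arcs whose graph is $\mathcal F$-measurable with closed values and whose graph restricted to jump indices $\le k$ is measurable w.r.t. $\sigma(\omega_1,\dots,\omega_k)$,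 such that for each $\omega$: $\pmb\tau_\omega(0,0)$ is the initial condition; on flow intervals $\pmb\tau_\omega\in C_\tau$ and $\dot{\pmb\tau}_\omega=\frac1T\mathbf 1_N$; if $(t,k),(t,k+1)\in\operatorname{dom}\pmb\tau_\omega$ then $\pmb\tau_\omega(t,k)\in D_\tau$ and $\pmb\tau_\omega(t,k+1)\in G_S(\pmb\tau_\omega(t,k),\omega_{k+1})$. A random solution is non-trivial if its domain has at least two points, complete if its domain is unbounded, maximal if it cannot be extended, uniformly non-Zeno if there are $\tilde T,\tilde K>0$ such that $t_2-t_1\le\tilde T$ implies $k_2-k_1\le\tilde K$ for $(t_i,k_i)$ in its domain. Synchronization set $\mathcal A_s:=\{\mu\mathbf 1_N:\mu\in[0,1]\}\cup\{0,1\}^N$. $\mathcal B$ (resp. $\mathcal B^\circ$) is the closed (open) unit ball. $\mathcal H_S$ renders $\mathcal A_s$ uniformly globally asymptotically stable in probability (UGASp) if: (a) for each $\varepsilon,\rho'>0$ there is $\delta>0$ such that every maximal random solution with $\pmb\tau_\omega(0,0)\in\mathcal A_s+\delta\mathcal B$ satisfies $\mathbb P(\pmb\tau_\omega(t,k)\in\mathcal A_s+\varepsilon\mathcal B^\circ\ \forall (t,k)\in\operatorname{dom}\pmb\tau_\omega)\ge1-\rho'$; (b) for each $\delta,\rho'>0$ there is $\varepsilon>0$ such that the same inequality holds; (c) for each $\varepsilon,\rho',R>0$ there is $\gamma\ge0$ such that every random solution with $\pmb\tau_\omega(0,0)\in\mathcal A_s+R\mathcal B$ satisfies $\mathbb P(\pmb\tau_\omega(t,k)\in\mathcal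 A_s+\varepsilon\mathcal B^\circ\ \forall (t,k)\in\operatorname{dom}\pmb\tau_\omega,\ t+k\ge\gamma)\ge1-\rho'$. $(p,r,\mathcal G)$ is a sync-triplet if (1) from every initial condition in $C_\tau\cup D_\tau$ there exist non-trivial random solutions almost surely, and every maximal random solution of $\mathcal H_S(p,r,\mathcal G)$ is almost surely complete and uniformly non-Zeno; and (2) $\mathcal H_S(p,r,\mathcal G)$ renders $\mathcal A_s$ UGASp. Sync-time: $\pmb T^*(\pmb\tau_\omega):=\inf\{t:\ (t,k)\in\operatorname{dom}\pmb\tau_\omega,\ \pmb\tau_\omega(t,k)\in\mathcal A_s\}$.
   Formalization: The tail bound is for maximal random solutions (a solution stopped at (0,0) unsynchronized has infinite sync-time); completeness is for initial conditions in C_τ∪D_τ; for N=1 (dep=0) the exponent dep−1 is read as 0, as otherwise ρ∈(0,1) fails for p≥1/2. *)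

(* Defs.v *)
From HB Require Import structures.
From mathcomp Require Import all_boot all_order all_algebra.
From mathcomp Require Import all_classical all_reals all_analysis.
Set Implicit Arguments. Unset Strict Implicit. Unset Printing Implicit Defensive.
Import Order.TTheory GRing.Theory Num.Theory.
Local Open Scope classical_set_scope.
Local Open Scope ring_scope.

Section SyncDefs.
Context {R : realType} {N : nat}.

Definition state := 'I_N -> R.

Definition simple_digraph (e : rel 'I_N) : Prop := irreflexive e.

Definition gpath (e : rel 'I_N) (i j : 'I_N) (s : seq 'I_N) : bool :=
  [&& path e i s, uniq (i :: s) & last i s == j].

Definition is_root (e : rel 'I_N) (i : 'I_N) : Prop :=
  forall j, j != i -> exists s, gpath e i j s.

Definition rooted (e : rel 'I_N) : Prop := exists i, is_root e i.

Definition has_path_len (e : rel 'I_N) (i j : 'I_N) (n : nat) : bool :=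
  `[< exists s, gpath e i j s /\ size s = n >].

(* depth of j w.r.t. i: length of a shortest path from i to j
   (only meaningful when j is reachable from i; 0 otherwise) *)
Definition depth (e : rel 'I_N) (i j : 'I_N) : nat :=
  match pselect (exists n, has_path_len e i j n) with
  | left h => ex_minn h
  | right _ => 0%N
  end.

Definition qstar (e : rel 'I_N) (i : 'I_N) : nat := \max_(j < N) depth e i j.

Definition dep (e : rel 'I_N) : nat :=
  \max_(i < N | `[< is_root e i >]) qstar e i.

Definition edges := {set 'I_N * 'I_N}.
Definition Eset (e : rel 'I_N) : edges := [set ij | e ij.1 ij.2]%SET.
Definition out_edges (e : rel 'I_N) (i : 'I_N) : edges :=
  [set ij | (ij.1 == i) && e ij.1 ij.2]%SET.
Definition Vstar (e : rel 'I_N) : {set 'I_N} := [set i | [exists j, e i j]]%SET.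

Definition feasible (e : rel 'I_N) (E' : edges) : bool :=
  (E' \subset Eset e) &&
  [forall i, (out_edges e i \subset E') || [disjoint out_edges e i & E']].

Definition vof (e : rel 'I_N) (E' : edges) (i : 'I_N) : bool :=
  out_edges e i \subset E'.

Definition mu (e : rel 'I_N) (p : R) (E' : edges) : R :=
  if feasible e E' then
    let N' := #|[set i in Vstar e | vof e E' i]%SET| in
    p ^+ N' * (1 - p) ^+ (#|Vstar e| - N')
  else 0.

Definition Cset (x : state) : Prop := forall i, 0 <= x i <= 1.
Definition Dset (x : state) : Prop :=
  (forall i, 0 <= x i <= 1) /\ \big[Num.max/0]_(i < N) x i = 1.

Definition Rj (rj s y : R) : Prop :=
  [/\ 0 <= s <= 1 &
   ((s < rj /\ y = 0) \/ (s = rj /\ (y = 0 \/ y = 1)) \/ (rj < s /\ y = 1))].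

(* outer-semicontinuous hull: graph = closure of graph of R_j *)
Definition Rbar (rj s y : R) : Prop :=
  forall eps, 0 < eps -> exists s' y', Rj rj s' y' /\ `|s - s'| < eps /\ `|y - y'| < eps.

Definition Sij (e : rel 'I_N) (r : 'I_N -> R) (E' : edges) (i j : 'I_N)
  (tauj gj : R) : Prop :=
  exists y, Rbar (r j) tauj y /\
    gj = (vof e E' i)%:R * y + (1 - (vof e E' i)%:R) * tauj.

Definition G0 (e : rel 'I_N) (r : 'I_N -> R) (tau : state) (E' : edges)
  (g : state) : Prop :=
  exists i, [/\ tau i = 1, (forall j, j != i -> 0 <= tau j < 1), g i = 0 &
    forall j, j != i ->
      (e i j -> Sij e r E' i j (tau j) (g j)) /\ (~~ e i j -> g j = tau j)].

(* G_S(., v): outer-semicontinuous hull of G0(., v) (closure of graph) *)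
Definition GS (e : rel 'I_N) (r : 'I_N -> R) (tau : state) (E' : edges)
  (g : state) : Prop :=
  forall eps, 0 < eps -> exists tau' g', G0 e r tau' E' g' /\
    (forall i, `|tau i - tau' i| < eps) /\ (forall i, `|g i - g' i| < eps).

Record harc := HArc { hdom : set (R * nat); hval : R -> nat -> state }.

Definition is_htd (E : set (R * nat)) : Prop :=
  (forall z, E z -> 0 <= z.1) /\
  forall T J, E (T, J) -> exists ts : nat -> R,
    [/\ ts 0%N = 0, (forall k, (k <= J)%N -> ts k <= ts k.+1), ts J.+1 = T &
     forall t k, (E (t, k) /\ t <= T /\ (k <= J)%N) <->
                 ((k <= J)%N /\ ts k <= t /\ t <= ts k.+1)].

Definition abs_cont_on (f : R -> R) (a b : R) : Prop :=
  forall eps, 0 < eps -> exists delta, 0 < delta /\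
   forall n (a_ b_ : 'I_n -> R),
     (forall k, a <= a_ k /\ a_ k <= b_ k /\ b_ k <= b) ->
     (forall k l, k != l -> b_ k <= a_ l \/ b_ l <= a_ k) ->
     \sum_(k < n) (b_ k - a_ k) < delta ->
     \sum_(k < n) `|f (b_ k) - f (a_ k)| < eps.

Definition loc_abs_cont (f : R -> R) (I : set R) : Prop :=
  forall a b, a <= b -> (forall s, a <= s <= b -> I s) -> abs_cont_on f a b.

Definition is_harc (x : harc) : Prop :=
  is_htd (hdom x) /\
  forall j i, loc_abs_cont (fun t => hval x t j i) [set t | hdom x (t, j)].

Definition interior_flow (x : harc) (t : R) (j : nat) : Prop :=
  exists eps, 0 < eps /\ forall s, `|s - t| < eps -> hdom x (s, j).

(* solution of H_S from xi, driven by the realized subgraphs om k = omega_{k+1} *)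
Definition is_hsol (e : rel 'I_N) (r : 'I_N -> R) (T : R) (x : harc)
  (xi : state) (om : nat -> edges) : Prop :=
  [/\ is_harc x, hdom x (0, 0%N), hval x 0 0%N = xi,
   (forall t j, interior_flow x t j ->
      Cset (hval x t j) /\ forall i, is_derive t 1 (fun s => hval x s j i) T^-1) &
   (forall t j, hdom x (t, j) -> hdom x (t, j.+1) ->
      Dset (hval x t j) /\ GS e r (hval x t j) (om j) (hval x t j.+1))].

Definition hgraph (x : harc) : set (R * R * state) :=
  [set z | exists t k, hdom x (t, k) /\ z = (t, k%:R, hval x t k)].
Definition hgraph_le (x : harc) (K : nat) : set (R * R * state) :=
  [set z | exists t k, [/\ hdom x (t, k), (k <= K)%N & z = (t, k%:R, hval x t k)]].

(* (Euclidean / equivalently sup-norm) open and closed subsets of R x R x R^N *)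
Definition open_tri (O : set (R * R * state)) : Prop :=
  forall z, O z -> exists eps, 0 < eps /\ forall z',
    `|z'.1.1 - z.1.1| < eps -> `|z'.1.2 - z.1.2| < eps ->
    (forall i, `|z'.2 i - z.2 i| < eps) -> O z'.
Definition closed_tri (F : set (R * R * state)) : Prop := open_tri (~` F).

Definition nontrivial (x : harc) : Prop :=
  exists z1 z2, hdom x z1 /\ hdom x z2 /\ z1 <> z2.
Definition complete (x : harc) : Prop :=
  forall M : R, exists t k, hdom x (t, k) /\ M < t + k%:R.
Definition unif_nonzeno (x : harc) : Prop :=
  exists Tt Kt : R, [/\ 0 < Tt, 0 < Kt &
    forall t1 k1 t2 k2, hdom x (t1, k1) -> hdom x (t2, k2) ->
      t2 - t1 <= Tt -> k2%:R - k1%:R <= Kt].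

Definition Async : set state :=
  [set x | (exists m : R, 0 <= m <= 1 /\ x = fun _ => m) \/
           (forall i, x i = 0 \/ x i = 1)].
Definition enorm (x : state) : R := Num.sqrt (\sum_(i < N) x i ^+ 2).
Definition nbhd_cl (delta : R) : set state :=
  [set x | exists a, Async a /\ enorm (fun i => x i - a i) <= delta].
Definition nbhd_op (eps : R) : set state :=
  [set x | exists a, Async a /\ enorm (fun i => x i - a i) < eps].

(* sync-time (inf of empty set = +oo) *)
Definition sync_time (x : harc) : \bar R :=
  ereal_inf [set t%:E | t in [set t | exists k, hdom x (t, k) /\ Async (hval x t k)]].

Section Prob.
Context {d : measure_display} {Omega : measurableType d}.
Variable P : probability Omega R.
(* om k = omega_{k+1}, the subgraph used at the (k+1)-st jump *)
Variable om : nat -> Omega -> edges.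

Definition iid_law (e : rel 'I_N) (p : R) : Prop :=
  (forall k (phi : edges), measurable [set w | om k w = phi]) /\
  forall n (phi : 'I_n -> edges),
    P (\bigcap_(k in [set k : 'I_n | True]) [set w | om k w = phi k]) =
    (\prod_(k < n) mu e p (phi k))%:E.

(* sigma(omega_1,...,omega_K) = sigma(om 0, ..., om (K-1)); since these are
   finitely-valued, its members are exactly the preimages of subsets *)
Definition sigma_meas (K : nat) (A : set Omega) : Prop :=
  exists B : set ('I_K -> edges), A = [set w | B (fun k => om k w)].

(* measurability of a set-valued map w |-> M w (Effros / Rockafellar-Wets) *)
Definition sv_meas_F (M : Omega -> set (R * R * state)) : Prop :=
  forall O, open_tri O -> measurable [set w | M w `&` O !=set0].
Definition sv_meas_K (K : nat) (M : Omega -> set (R * R * state)) : Prop :=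
  forall O, open_tri O -> sigma_meas K [set w | M w `&` O !=set0].

Definition rand_sol (e : rel 'I_N) (r : 'I_N -> R) (T : R)
  (X : Omega -> harc) (xi : state) : Prop :=
  [/\ sv_meas_F (fun w => hgraph (X w)),
      (forall w, closed_tri (hgraph (X w))),
      (forall K, sv_meas_K K (fun w => hgraph_le (X w) K)) &
      forall w, is_hsol e r T (X w) xi (fun k => om k w)].

Definition extends (X Y : harc) : Prop :=
  hdom X `<=` hdom Y /\ forall t k, hdom X (t, k) -> hval Y t k = hval X t k.

Definition max_rand_sol (e : rel 'I_N) (r : 'I_N -> R) (T : R)
  (X : Omega -> harc) (xi : state) : Prop :=
  rand_sol e r T X xi /\
  ~ exists Y, rand_sol e r T Y xi /\ (forall w, extends (X w) (Y w)) /\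
              exists w, hdom (X w) <> hdom (Y w).

(* inner probability lower bound: P(E) >= c *)
Definition prob_ge (E : set Omega) (c : R) : Prop :=
  exists A, [/\ measurable A, A `<=` E & (c%:E <= P A)%E].
(* outer probability upper bound: P(E) <= c *)
Definition prob_le (E : set Omega) (c : R) : Prop :=
  exists A, [/\ measurable A, E `<=` A & (P A <= c%:E)%E].

Definition stays (eps : R) (X : Omega -> harc) : set Omega :=
  [set w | forall t k, hdom (X w) (t, k) -> nbhd_op eps (hval (X w) t k)].
Definition stays_after (eps gamma : R) (X : Omega -> harc) : set Omega :=
  [set w | forall t k, hdom (X w) (t, k) -> gamma <= t + k%:R ->
     nbhd_op eps (hval (X w) t k)].

Definition UGASp (e : rel 'I_N) (r : 'I_N -> R) (T : R) : Prop :=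
  [/\ (forall eps rho', 0 < eps -> 0 < rho' -> exists delta, 0 < delta /\
         forall xi X, nbhd_cl delta xi -> max_rand_sol e r T X xi ->
           prob_ge (stays eps X) (1 - rho')),
      (forall delta rho', 0 < delta -> 0 < rho' -> exists eps, 0 < eps /\
         forall xi X, nbhd_cl delta xi -> max_rand_sol e r T X xi ->
           prob_ge (stays eps X) (1 - rho')) &
      (forall eps rho' Rad, 0 < eps -> 0 < rho' -> 0 < Rad ->
         exists gamma, 0 <= gamma /\
         forall xi X, nbhd_cl Rad xi -> rand_sol e r T X xi ->
           prob_ge (stays_after eps gamma X) (1 - rho'))].

Definition sync_triplet (e : rel 'I_N) (r : 'I_N -> R) (T : R) : Prop :=
  [/\ (forall xi, Cset xi \/ Dset xi ->
         exists X, rand_sol e r T X xi /\ {ae P, forall w, nontrivial (X w)}),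
      (forall xi X, Cset xi \/ Dset xi -> max_rand_sol e r T X xi ->
         {ae P, forall w, complete (X w) /\ unif_nonzeno (X w)}) &
      UGASp e r T].

End Prob.
End SyncDefs.

(* Main.v *)
(** Stability is deterministic: an arc of length [s < min (r, 1 - r)] of the circle [0,1]/0~1
    that contains all clocks stays such an arc under flow and jumps. Non-Zenoness comes from a
    count of the clocks that are above threshold at the end of a short window. A solution that
    stops can be continued on the cylinder of sample points with the same past, so maximal
    solutions are complete.

    For the sync-time, finitely many favourable draws synchronize any state. First every vertex
    fires until a root [i] does; its out-neighbours are then at 0 or 1. When all vertices within
    distance [q] of [i] are at 0 or 1, wait until they are all at 0, let nobody fire until they
    reach 1 together, then let exactly those at distance [q] fire: all vertices within distance
    [q + 1] are now at 0 or 1. Each stage needs at most [N] prescribed draws, because every jump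
    lowers a count of clocks. So a round takes time at most [dep e * T] and succeeds with
    probability bounded below given the past, and rounds are chained by conditioning on
    cylinders of the i.i.d. sequence. *)
Require Import Defs.
From HB Require Import structures.
From mathcomp Require Import all_boot all_order all_algebra.
From mathcomp Require Import all_classical all_reals all_analysis.
From mathcomp Require Import zify lra.
Import Order.TTheory GRing.Theory Num.Theory.
Import numFieldNormedType.Exports.
Local Open Scope classical_set_scope.
Local Open Scope ring_scope.

(** * The jump map *)

Section Jumps.
Set Implicit Arguments. Unset Strict Implicit.
Context {R : realType} {N : nat}.
Implicit Types (e : rel 'I_N) (r : 'I_N -> R) (u g z : @state R N) (E : @edges N).

(** The jump map is set-valued, and a random solution may choose its values as it likes given the
    past and may even stop, so there is no Markov chain to condition. What remains is causality: the
    draws take finitely many values, so the arc up to jump [K] is a function of the first [K] draws,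
    and lateness at a fixed time is a finite union of cylinders. A strategy has to succeed against
    every admissible jump. It is therefore played as a game on an abstract predicate [W], in which a
    jump under an arbitrary draw is free and a prescribed draw multiplies the bound by its
    probability.

    The exponent in [rho] comes from counting prescribed draws. The layers that fire are disjoint,
    so in one round [p] occurs at most [2 * N * N] times and [1 - p] at most
    [2 * N * N * (dep e - 1)] times, while [lstar] is at least [2 * N]. The additional [T] in the
    length of a round guarantees that a solution that reaches the final time has jumped when the
    strategy expects it to. *)

Lemma ord_min_gt0 n (f : 'I_n -> R) : (forall i, 0 < f i) ->
  exists m, 0 < m <= 1 /\ forall i, m <= f i.
Proof.
move=> f0; exists (\big[Num.min/1]_i f i); split; last by move=> i; exact: bigmin_le.
by rewrite lt_bigmin //= bigmin_le_id.
Qed.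

(** Moves a finite choice out of a closure. A point of the closure of a graph has a witness for each
    [eps], possibly in a different branch; with finitely many branches, each monotone in [eps], one
    branch serves all [eps]. *)
Lemma eps_pigeonhole n (Q : 'I_n -> R -> Prop) :
  (forall i a b, a <= b -> Q i a -> Q i b) ->
  (forall eps, 0 < eps -> exists i, Q i eps) ->
  exists i, forall eps, 0 < eps -> Q i eps.
Proof.
move=> mono QH; apply: contrapT => /forallNP noi.
have /choice[f fP] : forall i, exists a, 0 < a /\ ~ Q i a.
  move=> i; apply: contrapT => /forallNP na; apply: (noi i) => a a0.
  by apply: contrapT => nq; apply: (na a).
have [|m [/andP[m0 _] mf]] := @ord_min_gt0 _ f; first by move=> i; case: (fP i).
have [i Qi] := QH m m0.
by case: (fP i) => _; apply; apply: mono Qi.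
Qed.

Lemma eps_disj (A B : R -> Prop) :
  (forall a b, a <= b -> A a -> A b) -> (forall a b, a <= b -> B a -> B b) ->
  (forall eps, 0 < eps -> A eps \/ B eps) ->
  (forall eps, 0 < eps -> A eps) \/ (forall eps, 0 < eps -> B eps).
Proof.
move=> mA mB AB.
have [||i] := @eps_pigeonhole 2 (fun i => if val i == 0%N then A else B).
- by move=> i a b; case: ifP => _; [exact: mA|exact: mB].
- move=> eps /AB[a|b]; first by exists ord0.
  by exists ord_max.
by case: ifP => _ h; [left|right].
Qed.

Lemma eq_eps (a b : R) : (forall eps, 0 < eps -> `|a - b| < eps) -> a = b.
Proof.
move=> h; apply/eqP; rewrite -subr_eq0 -normr_eq0; apply/negPn/negP => n0.
by have := h `|a - b|; rewrite ltxx lt_neqAle eq_sym n0 normr_ge0 => /(_ isT).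
Qed.

Lemma le_eps (a b : R) : (forall eps, 0 < eps -> a < b + eps) -> a <= b.
Proof.
move=> h; rewrite leNgt; apply/negP => ba.
by have := h (a - b); rewrite subr_gt0 => /(_ ba); lra.
Qed.

Lemma Rbar_cases (rj s y : R) : Rbar rj s y ->
  0 <= s <= 1 /\ ((s <= rj /\ y = 0) \/ (rj <= s /\ y = 1)).
Proof.
move=> H; split.
  apply/andP; split; apply: le_eps => eps e0;
    have [s' [y' [[/andP[a b] _] [h _]]]] := H _ e0;
    by move: h; rewrite ltr_norml => /andP[]; lra.
have [|||h|h] := @eps_disj
   (fun eps => s < rj + eps /\ `|y - 0| < eps) (fun eps => rj < s + eps /\ `|y - 1| < eps).
- by move=> a b ab; rewrite !ltr_norml => -[? /andP[]]; split; [lra|apply/andP; lra].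
- by move=> a b ab; rewrite !ltr_norml => -[? /andP[]]; split; [lra|apply/andP; lra].
- move=> eps e0; have [s' [y' [[_ c] [hs hy]]]] := H _ e0.
  move: hs; rewrite ltr_norml => /andP[h1 h2].
  case: c => [[c d]|[[c [d|d]]|[c d]]]; rewrite d in hy.
  + by left; split => //; lra.
  + by left; split => //; lra.
  + by right; split => //; lra.
  + by right; split => //; lra.
- by left; split; [apply: le_eps => eps /h[]|apply: eq_eps => eps /h[]].
- by right; split; [apply: le_eps => eps /h[]|apply: eq_eps => eps /h[]].
Qed.

Lemma Rj_Rbar (rj s y : R) : Rj rj s y -> Rbar rj s y.
Proof. by move=> h eps e0; exists s, y; rewrite !subrr normr0. Qed.

(** The form in which the closed graph of [GS] is used. In the closure several clocks may be at 1,
    yet one jump resets a single vertex [i]; [b] tells whether [i] fires. *)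
Definition jump e r i (b : bool) u g : Prop :=
  [/\ u i = 1, Cset u, g i = 0 & forall j, j != i ->
    if e i j && b then (u j <= r j /\ g j = 0) \/ (r j <= u j /\ g j = 1)
    else g j = u j].

Lemma GS_jump e r u E g : GS e r u E g -> exists i, jump e r i (vof e E i) u g.
Proof.
move=> H.
pose Q i eps := exists u' g',
  [/\ u' i = 1, (forall j, j != i -> 0 <= u' j < 1), g' i = 0,
    (forall j, j != i -> (e i j -> Sij e r E i j (u' j) (g' j)) /\
                         (~~ e i j -> g' j = u' j)) &
    (forall j, `|u j - u' j| < eps) /\ (forall j, `|g j - g' j| < eps)].
have [||i Qi] := @eps_pigeonhole N Q.
- move=> i a b ab [u' [g' [h1 h2 h3 h4 [h5 h6]]]]; exists u', g'; split => //.
  by split => j; [apply: lt_le_trans (h5 j) _|apply: lt_le_trans (h6 j) _].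
- move=> eps e0; have [u' [g' [[i [h1 h2 h3 h4]] [h5 h6]]]] := H _ e0.
  by exists i, u', g'.
exists i.
have ui : u i = 1.
  by apply: eq_eps => eps /Qi[u' [g' [<- _ _ _ [/(_ i)]]]].
have gi : g i = 0.
  by apply: eq_eps => eps /Qi[u' [g' [_ _ <- _ [_ /(_ i)]]]].
split => //.
  move=> j; have [->|ji] := eqVneq j i; first by rewrite ui; lra.
  apply/andP; split; apply: le_eps => eps /Qi[u' [g' [_ /(_ j ji)/andP[a b] _ _ [/(_ j)]]]];
    by rewrite ltr_norml => /andP[? ?] _; lra.
move=> j ji; case: ifPn => [/andP[eij vi]|]; last first.
  rewrite negb_and => h; apply: eq_eps => eps e0.
  have /Qi : 0 < eps / 2 by lra.
  move=> [u' [g' [_ _ _ /(_ j ji)[h1 h2] [/(_ j) hu /(_ j) hg]]]].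
  have E1 : g' j = u' j.
    case/orP: h => [/h2//|nv]; case: (boolP (e i j)) => [/h1|/h2//].
    by move=> [y [_ ->]]; rewrite (negbTE nv) mul0r add0r subr0 mul1r.
  rewrite E1 in hg; move: hu hg; rewrite !ltr_norml => /andP[? ?] /andP[? ?].
  by apply/andP; lra.
have [|||h|h] := @eps_disj
   (fun eps => u j < r j + eps /\ `|g j - 0| < eps) (fun eps => r j < u j + eps /\ `|g j - 1| < eps).
- by move=> a b ab; rewrite !ltr_norml => -[? /andP[]]; split; [lra|apply/andP; lra].
- by move=> a b ab; rewrite !ltr_norml => -[? /andP[]]; split; [lra|apply/andP; lra].
- move=> eps /Qi[u' [g' [_ _ _ /(_ j ji)[/(_ eij) [y [/Rbar_cases [_ hy]]] + _] [/(_ j) hu /(_ j) hg]]]].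
  rewrite vi subrr mul0r addr0 mul1r => gE; rewrite gE in hg.
  move: hu; rewrite ltr_norml => /andP[? ?].
  by case: hy => -[? yE]; rewrite yE in hg; [left|right]; split => //; lra.
- by left; split; [apply: le_eps => eps /h[]|apply: eq_eps => eps /h[]].
- by right; split; [apply: le_eps => eps /h[]|apply: eq_eps => eps /h[]].
Qed.

(** [G0] is empty where two clocks are at 1. Lowering all of them except [i] by [h], smaller than
    every [1 - r j], leaves them above threshold, so they respond as they would at 1, and the
    closure supplies the value at [u]. *)
Lemma GS_total e r u E i : (forall j, 0 < r j < 1) -> Cset u -> u i = 1 ->
  exists g, GS e r u E g.
Proof.
move=> r01 Cu ui.
pose f j : R := if u j <= r j then 0 else 1.
pose g j := if j == i then 0 else if e i j && vof e E i then f j else u j.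
exists g => eps e0.
have [|m [/andP[m0 _] mr]] := @ord_min_gt0 N (fun j => 1 - r j).
  by move=> j; case/andP: (r01 j); lra.
have [h [h0 he hm]] : exists h, [/\ 0 < h, h < eps & h < m].
  exists (Num.min eps m / 2); have [?|?] := leP eps m; split; lra.
pose u' j := if (j != i) && (u j == 1) then 1 - h else u j.
have close j : `|u j - u' j| < eps.
  rewrite /u'; case: ifP => [/andP[_ /eqP->]|_]; last by rewrite subrr normr0.
  by rewrite ltr_norml; apply/andP; lra.
have u'01 j : j != i -> 0 <= u' j < 1.
  rewrite /u' => ->/=; have /andP[? ?] := r01 j; have := mr j; have /andP[u0 u1] := Cu j.
  case: eqVneq => [_ ?|n _]; first by apply/andP; split; lra.
  by rewrite u0 lt_neqAle n.
exists u', (fun j => if j == i then 0 else if e i j && vof e E i then f j else u' j).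
split; last split => // j.
  exists i; split => //; [by rewrite /u' eqxx|by rewrite eqxx|].
  move=> j ji; rewrite (negbTE ji); split=> [eij|/negbTE->//].
  exists (f j); rewrite eij /=; split; last by case: (vof _ _ _); rewrite ?subrr ?subr0 !(mul0r, mul1r) ?addr0 ?add0r.
  apply: Rj_Rbar; split; first by have := u'01 _ ji; lra.
  rewrite /f /u' ji /=; have /andP[? ?] := r01 j; have := mr j.
  have [uE|un] := eqVneq (u j) 1.
    have -> : (u j <= r j) = false by apply/negbTE; rewrite -ltNge uE; lra.
    by move=> ?; right; right; split => //; lra.
  case: ltgtP => [?|?|->] ?; [by left|by right; right|by right; left; split => //; left].
rewrite /g; have [_|_] := eqVneq j i; first by rewrite subrr normr0.
by case: (e i j && _); rewrite ?subrr ?normr0.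
Qed.

Lemma jump_Cset e r i b u g : jump e r i b u g -> Cset g.
Proof.
move=> [_ Cu gi h] j; have [->|ji] := eqVneq j i; first by rewrite gi; lra.
by move: (h j ji); case: ifP => _; [case=> -[_ ->]; lra|move->].
Qed.

(** * Consequences of thresholds strictly between 0 and 1 *)

Section Thresholds.
Context {r : 'I_N -> R} (r01 : forall j, 0 < r j < 1).

Lemma jump_keep0 e i b u g j : jump e r i b u g -> u j = 0 -> g j = 0.
Proof.
move=> [_ Cu gi h] uj; have [->//|ji] := eqVneq j i.
by move: (h j ji) (r01 j); rewrite uj; case: ifP => _; [case=> -[? ->]; lra|move->].
Qed.

Lemma jump_keep1 e i b u g j : jump e r i b u g -> j != i -> u j = 1 -> g j = 1.
Proof.
move=> [_ Cu gi h] ji uj.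
by move: (h j ji) (r01 j); rewrite uj; case: ifP => _; [case=> -[? ->]; lra|move->].
Qed.

Lemma jump_keep01 e i b u g j : jump e r i b u g ->
  u j = 0 \/ u j = 1 -> g j = 0 \/ g j = 1.
Proof.
move=> J [|] uj; first by left; apply: jump_keep0 J uj.
have [->|ji] := eqVneq j i; first by left; case: J.
by right; apply: jump_keep1 J ji uj.
Qed.

Lemma jump_out01 e i u g j : jump e r i true u g -> e i j -> g j = 0 \/ g j = 1.
Proof.
move=> [_ Cu gi h] eij; have [->|ji] := eqVneq j i; first by left.
by move: (h j ji); rewrite eij /= => -[[_ ->]|[_ ->]]; [left|right].
Qed.

(** The potential behind both counts: with [h > 0] it looks ahead to the end of a time window, with
    [h = 0] it bounds the number of jumps at one instant. *)
Definition above h u : {set 'I_N} := [set j | r j <= u j + h]%SET.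

(** A clock goes to 1 only if it already was at or above its threshold, a clock sent to 0 stays
    below because [h < r j], and the reset clock [i] leaves the set. *)
Lemma jump_above e i b u g h : 0 <= h -> (forall j, h < r j) ->
  jump e r i b u g -> (#|above h g| < #|above h u|)%N.
Proof.
move=> h0 hr [ui Cu gi J]; apply: proper_card; apply/properP; split.
  apply/fintype.subsetP => j; rewrite !inE; have [->|ji] := eqVneq j i.
    by rewrite gi ui; have := r01 i; lra.
  by move: (J j ji); have := hr j; case: ifP => _; [move=> ? [] [? ->]; lra|move=> _ ->].
by exists i; rewrite inE ?ui ?gi; have := r01 i; have := hr i; lra.
Qed.

End Thresholds.
End Jumps.

(** * Solutions along their time domain *)

Section Arcs.
Set Implicit Arguments. Unset Strict Implicit.
Context {R : realType} {N : nat}.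

Lemma abs_cont_within (f : R -> R) (a b : R) : abs_cont_on f a b ->
  {within `[a, b], continuous f}.
Proof.
move=> H; apply/subspace_continuousP => x; rewrite /= in_itv /= => /andP[ax xb].
apply/cvgrPdist_lt => eps e0; have [dl [d0 hd]] := H _ e0.
rewrite near_withinE; near=> y; rewrite /= in_itv /= => /andP[ay yb].
have yx : `|x - y| < dl by near: y; apply: nbhsx_ballx.
have pair u v : a <= u -> u <= v -> v <= b -> v - u < dl -> `|f v - f u| < eps.
  move=> au uv vb vu.
  have := hd 1%N (fun=> u) (fun=> v); rewrite !big_ord1; apply => //.
  by move=> k l; rewrite !ord1 eqxx.
move: yx; rewrite ltr_norml => /andP[? ?].
have [yx|xy] := leP y x; first by apply: pair; lra.
by rewrite distrC; apply: pair; lra.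
Unshelve. all: by end_near. Qed.

Context {e : rel 'I_N} {r : 'I_N -> R} {T : R} {x : @harc R N} {xi : @state R N}
  {om : nat -> @edges N}.
Context (T0 : 0 < T).
Context (H : is_hsol e r T x xi om).

Lemma hsol_dom_itv s t v k : hdom x (s, k) -> hdom x (t, k) -> s <= v <= t ->
  hdom x (v, k).
Proof.
case: H => -[[_ htd] _] _ _ _ _ ds dt /andP[sv vt].
have [ts [_ _ tst E]] := htd _ _ dt.
have [|_ [h1 _]] := (E s k).1; first by split=> //; split => //; exact: le_trans vt.
by apply: (proj1 ((E v k).2 _)); split => //; split => //; [exact: le_trans sv|rewrite tst].
Qed.

Lemma hsol_interior s t v k : hdom x (s, k) -> hdom x (t, k) -> s < v < t ->
  interior_flow x v k.
Proof.
move=> ds dt /andP[sv vt].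
exists (Num.min (v - s) (t - v)); split; first by rewrite lt_min !subr_gt0 sv vt.
move=> w; rewrite lt_min !ltr_norml => /andP[/andP[? ?] /andP[? ?]].
by apply: (hsol_dom_itv ds dt); apply/andP; split; lra.
Qed.

(** The derivative is prescribed in the interior of the interval only; absolute continuity gives
    continuity up to the ends, as the mean value theorem demands. *)
Lemma hsol_affine s t k i : hdom x (s, k) -> hdom x (t, k) -> s <= t ->
  hval x t k i = hval x s k i + (t - s) / T.
Proof.
move=> ds dt; rewrite le_eqVlt => /orP[/eqP->|st]; first by rewrite subrr mul0r addr0.
case: (H) => -[_ ac] _ _ flow _.
have [||c _ E] := @MVT _ (fun v => hval x v k i) (fun=> T^-1) s t st.
- move=> v; rewrite in_itv /= => sv.
  by have [_] := flow _ _ (hsol_interior ds dt sv); exact.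
- apply: abs_cont_within; apply: (ac k i) => //=; first exact: ltW.
  by move=> w; exact: hsol_dom_itv ds dt.
by rewrite mulrC -E; lra.
Qed.

(** The flow set constrains interior times only; the ends follow by letting an interior time tend to
    them. *)
Lemma hsol_flow_Cset s t k : hdom x (s, k) -> hdom x (t, k) -> s < t ->
  Cset (hval x s k) /\ Cset (hval x t k).
Proof.
move=> ds dt st.
have C v : s < v < t -> Cset (hval x v k).
  by move=> sv; case: (H) => _ _ _ flow _; case: (flow _ _ (hsol_interior ds dt sv)).
have TV : 0 < T^-1 by rewrite invr_gt0.
have lo i : 0 <= hval x s k i.
  apply: le_eps => eps e0.
  have [h [h0 h1 h2]] : exists h, [/\ 0 < h, h < t - s & h / T < eps].
    have [?|?] := leP (t - s) (eps * T).
      by exists ((t - s) / 2); split; rewrite ?ltr_pdivrMr //; lra.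
    have ? : 0 < eps * T by rewrite mulr_gt0.
    by exists (eps * T / 2); split; rewrite ?ltr_pdivrMr //; lra.
  have sv : s < s + h < t by apply/andP; split; lra.
  have dv : hdom x (s + h, k) by apply: (hsol_dom_itv ds dt); apply/andP; split; lra.
  have /andP[+ _] := C _ sv i; rewrite (hsol_affine i ds dv); last lra.
  by rewrite (_ : s + h - s = h); lra.
have hi i : hval x t k i <= 1.
  apply: le_eps => eps e0.
  have [h [h0 h1 h2]] : exists h, [/\ 0 < h, h < t - s & h / T < eps].
    have [?|?] := leP (t - s) (eps * T).
      by exists ((t - s) / 2); split; rewrite ?ltr_pdivrMr //; lra.
    have ? : 0 < eps * T by rewrite mulr_gt0.
    by exists (eps * T / 2); split; rewrite ?ltr_pdivrMr //; lra.
  have sv : s < t - h < t by apply/andP; split; lra.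
  have dv : hdom x (t - h, k) by apply: (hsol_dom_itv ds dt); apply/andP; split; lra.
  have /andP[_ +] := C _ sv i; rewrite (hsol_affine i dv dt); last lra.
  by rewrite (_ : t - (t - h) = h); lra.
have pos : 0 <= (t - s) / T by rewrite divr_ge0 ?subr_ge0 // ltW.
by split => i; move: (lo i) (hi i); rewrite (hsol_affine i ds dt (ltW st)) => *;
  apply/andP; split; lra.
Qed.

Lemma hsol_jump t k : hdom x (t, k) -> hdom x (t, k.+1) ->
  exists i, jump e r i (vof e (om k) i) (hval x t k) (hval x t k.+1).
Proof. by move=> d1 d2; case: H => _ _ _ _ /(_ _ _ d1 d2)[_ /GS_jump]. Qed.

(* The definition of a hybrid time domain does not by itself prevent flow past a jump time;
   here it is excluded because some coordinate equals 1 at a jump. *)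
Lemma hsol_jump_last t k s : hdom x (t, k) -> hdom x (t, k.+1) -> hdom x (s, k) -> s <= t.
Proof.
move=> d1 d2 d3; rewrite leNgt; apply/negP => ts.
have [i [ui _ _ _]] := hsol_jump d1 d2.
have [_ /(_ i)/andP[_]] := hsol_flow_Cset d1 d3 ts.
have pos : 0 < (s - t) / T by rewrite divr_gt0 ?subr_gt0.
by rewrite (hsol_affine i d1 d3 (ltW ts)) ui; lra.
Qed.

Lemma hsol_dom_jump t k k0 : hdom x (t, k) -> (k0 < k)%N ->
  exists t', [/\ t' <= t, hdom x (t', k0) & hdom x (t', k0.+1)].
Proof.
move=> dt kk; case: (H) => -[[_ htd] _] _ _ _ _.
have [ts [_ mono tst E]] := htd _ _ dt.
have mon a b : (a <= b)%N -> (b <= k.+1)%N -> ts a <= ts b.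
  elim: b => [|b IH]; first by rewrite leqn0 => /eqP->.
  rewrite leq_eqVlt => /orP[/eqP->//|ab bk].
  by apply: le_trans (IH ab (ltnW bk)) _; apply: mono.
exists (ts k0.+1); split; first by rewrite -tst mon // ltnW.
- by apply: (proj1 ((E (ts k0.+1) k0).2 _)); rewrite (ltnW kk) lexx mono // ltnW.
- by apply: (proj1 ((E (ts k0.+1) k0.+1).2 _)); rewrite kk lexx mono.
Qed.

Lemma hsol_dom_le t k t0 k0 : hdom x (t0, k0) -> hdom x (t, k) -> (k0 < k)%N -> t0 <= t.
Proof.
move=> d0 dt /(hsol_dom_jump dt)[t' [t't d1 d2]].
exact: le_trans (hsol_jump_last d1 d2 d0) t't.
Qed.

Lemma hsol_dom_lt t k t0 k0 : hdom x (t0, k0) -> hdom x (t, k) -> t0 < t -> (k0 <= k)%N.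
Proof.
move=> d0 dt tt; rewrite leqNgt; apply/negP => kk.
by have := hsol_dom_le dt d0 kk; rewrite leNgt tt.
Qed.

Lemma hsol_ind (Q : R -> nat -> Prop) t0 k0 : hdom x (t0, k0) -> Q t0 k0 ->
  (forall s t k, t0 <= s -> s <= t -> hdom x (s, k) -> hdom x (t, k) -> Q s k -> Q t k) ->
  (forall t k, t0 <= t -> hdom x (t, k) -> hdom x (t, k.+1) -> Q t k -> Q t k.+1) ->
  forall t k, hdom x (t, k) -> t0 <= t -> (k0 <= k)%N -> Q t k.
Proof.
move=> d0 Q0 flow jmp t k; elim: k t => [|k IH] t dt t0t.
  by rewrite leqn0 => /eqP k00; subst k0; exact: (flow t0).
rewrite leq_eqVlt => /orP[/eqP kE|]; first by subst k0; exact: (flow t0).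
rewrite ltnS => kk.
have [t' [t't d1 d2]] := hsol_dom_jump dt (ltnSn k).
have t0t' : t0 <= t' by apply: hsol_dom_le d0 d2 _.
by apply: (flow t') => //; apply: jmp => //; exact: IH.
Qed.

Lemma hsol_dom00 : hdom x (0, 0%N). Proof. by case: H. Qed.

Lemma hsol_dom_ge0 t k : hdom x (t, k) -> 0 <= t.
Proof. by case: H => -[[+ _] _] _ _ _ _ => h /h. Qed.

Lemma hsol_ind0 (Q : R -> nat -> Prop) : Q 0 0%N ->
  (forall s t k, s <= t -> hdom x (s, k) -> hdom x (t, k) -> Q s k -> Q t k) ->
  (forall t k, hdom x (t, k) -> hdom x (t, k.+1) -> Q t k -> Q t k.+1) ->
  forall t k, hdom x (t, k) -> Q t k.
Proof.
move=> Q0 flow jmp t k dt.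
apply: (hsol_ind hsol_dom00 Q0) => //; last exact: hsol_dom_ge0 dt.
- by move=> s t' k' _; exact: flow.
- by move=> t' k' _; exact: jmp.
Qed.

Lemma hsol_Cset : Cset xi -> forall t k, hdom x (t, k) -> Cset (hval x t k).
Proof.
move=> Cxi; apply: hsol_ind0.
- by case: H => _ _ ->.
- move=> s t k; rewrite le_eqVlt => /orP[/eqP->//|st] ds dt _.
  by case: (hsol_flow_Cset ds dt st).
- by move=> t k d1 d2 _; have [i /jump_Cset] := hsol_jump d1 d2.
Qed.

(** Neighbourhoods of [Async] leave the unit cube, so stability also concerns initial states from
    which neither flow nor jump is possible. *)
Lemma hsol_trivial : ~ Cset xi -> forall t k, hdom x (t, k) -> t = 0 /\ k = 0%N.
Proof.
move=> nC; have v0 : hval x 0 0 = xi by case: H.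
apply: hsol_ind0 => //.
- move=> s t k + + + [s0 k0]; subst s k.
  rewrite le_eqVlt => /orP[/eqP<-//|st] ds dt.
  by case: (hsol_flow_Cset ds dt st); rewrite v0.
- move=> t k + + [t0 k0]; subst t k => d1 d2.
  by have [i [_]] := hsol_jump d1 d2; rewrite v0.
Qed.

End Arcs.

(** * Non-Zenoness and stability *)

Section NonZeno.
Set Implicit Arguments. Unset Strict Implicit.
Context {R : realType} {N : nat} {e : rel 'I_N} {r : 'I_N -> R} {T : R}.
Context (r01 : forall j, 0 < r j < 1).
Context (T0 : 0 < T).

Section OneArc.
Context {x : @harc R N} {xi : @state R N} {om : nat -> @edges N}.
Context (H : is_hsol e r T x xi om).

Lemma hsol_dom_at t k s : hdom x (t, k) -> 0 <= s <= t -> exists k', hdom x (s, k').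
Proof.
move=> + /andP[s0]; elim: k t => [|k IH] t dt st.
  by exists 0%N; apply: (hsol_dom_itv H (hsol_dom00 H) dt); rewrite s0.
have [t' [t't d1 d2]] := hsol_dom_jump H dt (ltnSn k).
have [st'|t's] := leP s t'; first exact: IH d1 st'.
by exists k.+1; apply: (hsol_dom_itv H d2 dt); rewrite st ltW.
Qed.

(* Counting the clocks that would be at or above their threshold at the end of a short window:
   flow does not change this number and every jump decreases it. *)
Lemma hsol_window m t1 k1 t2 k2 : (forall j, m <= r j) ->
  hdom x (t1, k1) -> hdom x (t2, k2) -> t1 <= t2 -> (k1 <= k2)%N -> t2 - t1 < m * T ->
  (k2 <= N + k1)%N.
Proof.
move=> mr d1 d2 t12 k12 w.
pose c t k := #|above (r := r) ((t2 - t) / T) (hval x t k)|.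
pose Q t k := t <= t2 -> (c t k + k <= N + k1)%N.
suff : Q t2 k2.
  by move=> /(_ (lexx _)); apply: leq_trans; exact: leq_addl.
apply: (hsol_ind T0 (Q := Q) H d1) d2 t12 k12 => [_|s t k ts st ds dt|t k t1t ds dt].
- by rewrite leq_add2r -[X in (_ <= X)%N]card_ord max_card.
- move=> IH tt2; suff -> : c t k = c s k by apply: IH; exact: le_trans tt2.
  rewrite /c; apply: eq_card => j; rewrite !inE (hsol_affine H j ds dt st).
  by rewrite -addrA -mulrDl (_ : t - s + (t2 - t) = t2 - s) //; lra.
- move=> IH tt2; have [i J] := hsol_jump H ds dt.
  apply: leq_trans (IH tt2); rewrite addnS ltn_add2r; apply: (jump_above r01 _ _ J).
    by rewrite divr_ge0 ?subr_ge0 // ltW.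
  by move=> j; apply: lt_le_trans (mr j); rewrite ltr_pdivrMr //; lra.
Qed.

Lemma hsol_unif_nonzeno : (0 < N)%N -> unif_nonzeno x.
Proof.
move=> N0; have [m [/andP[m0 m1] mr]] := @ord_min_gt0 _ _ r (fun i => proj1 (andP (r01 i))).
have mT : 0 < m * T by rewrite mulr_gt0.
exists (m * T / 2), N%:R; split; [by rewrite divr_gt0|by rewrite ltr0n|].
move=> t1 k1 t2 k2 d1 d2 w.
have [k21|k12] := leqP k2 k1.
  by rewrite (@le_trans _ _ 0) // subr_le0 ler_nat.
rewrite lerBlDr -natrD ler_nat; apply: (hsol_window mr d1 d2) => //.
- exact: (hsol_dom_le T0 H d1 d2 k12).
- exact: ltnW.
- by lra.
Qed.
End OneArc.

(** The bound is uniform over solutions and draws: [[0, s]] is cut into windows of length [w], each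
    with at most [N] jumps. Events at time [s] thus depend on [K] draws, and the game before [s] is
    finite. *)
Lemma hsol_jump_count (s : R) : exists K, forall x xi om t k,
  @is_hsol R N e r T x xi om -> hdom x (t, k) -> t <= s -> (k <= K)%N.
Proof.
have [m [/andP[m0 m1] mr]] := @ord_min_gt0 _ _ r (fun i => proj1 (andP (r01 i))).
have mT : 0 < m * T by rewrite mulr_gt0.
pose w := m * T / 2; have w0 : 0 < w by rewrite divr_gt0.
suff count n x xi om t k : @is_hsol R N e r T x xi om -> hdom x (t, k) -> t <= n%:R * w ->
    (k <= N * n.+1)%N.
  have [s0|s0] := leP s 0.
    by exists (N * 1)%N => x xi om t k H dt ts; apply: (count 0%N) H dt _; rewrite mul0r; lra.
  exists (N * (Num.truncn (s / w)).+2)%N => x xi om t k H dt ts.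
  apply: (count _) H dt _; apply: le_trans ts _.
  rewrite -ler_pdivrMr //; apply/ltW; apply: truncnS_gt.
move=> H; elim: n t k => [|n IH] t k dt tn.
  have t0 : t = 0 by apply: le_anti; rewrite (hsol_dom_ge0 H dt) andbT; lra.
  subst t; rewrite muln1 -[X in (_ <= X)%N]addn0.
  by apply: (hsol_window H mr (hsol_dom00 H) dt) => //; rewrite subrr.
have [tn'|nt] := leP t (n%:R * w).
  by apply: leq_trans (IH _ _ dt tn') _; rewrite leq_mul2l leqnSn orbT.
have [|k' dk'] := hsol_dom_at H dt (s := n%:R * w).
  by rewrite (ltW nt) andbT mulr_ge0 // ltW.
rewrite mulnS; apply: leq_trans (_ : N + k' <= _)%N; last by rewrite leq_add2l (IH _ _ dk').
have kk := hsol_dom_lt T0 H dk' dt nt.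
apply: (hsol_window H mr dk' dt) => //; first exact: ltW.
by move: tn; rewrite -natr1 mulrDl mul1r /w; lra.
Qed.

End NonZeno.

(** * Invariance of short arcs of the circle *)

Section Stability.
Set Implicit Arguments. Unset Strict Implicit.
Context {R : realType} {N : nat} {e : rel 'I_N} {r : 'I_N -> R} {T : R}.
Context (r01 : forall j, 0 < r j < 1).
Context (T0 : 0 < T).
Context (N0 : (0 < N)%N).
Implicit Types (u g z : @state R N).

(* All clocks lie on an arc of length [s] of the circle [0,1]/0~1; in the second case the arc
   contains the point 0~1 at distance [b] from its front end. *)
Definition in_arc (s : R) z : Prop :=
  (exists a, forall i, a <= z i <= a + s) \/
  (exists b, 0 <= b <= s /\ forall i, z i <= b \/ 1 - s + b <= z i).

Lemma in_arc_flow s z h : 0 <= s -> 0 <= h -> Cset z -> Cset (fun i => z i + h) ->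
  in_arc s z -> in_arc s (fun i => z i + h).
Proof.
move=> s0 h0 Cz Czh [[a az]|[b [/andP[b0 bs] bz]]].
  by left; exists (a + h) => i; have /andP[? ?] := az i; apply/andP; split; lra.
(* A clock in the rear piece must not pass 1, which gives [b + h <= s]. If the rear piece is empty,
   the arc is the interval [[0, b]], and it is merely shifted. *)
have [[i zi]|ni] := pselect (exists i, 1 - s + b <= z i).
  right; exists (b + h); split; last by move=> j; case: (bz j) => ?; [left|right]; lra.
  by have /andP[_] := Czh i => /= ?; apply/andP; split; lra.
left; exists h => i; have /andP[? ?] := Cz i.
by case: (bz i) => [?|bi]; [apply/andP; split; lra|case: ni; exists i].
Qed.

(** Since some clock is at 1, the arc touches 0~1. Clocks in front of this point are below threshold
    and go to 0, those behind it are above threshold and go to 1: a pulse only moves clocks to the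
    point 0~1 of the arc. *)
Lemma in_arc_jump s i b u g : 0 <= s -> (forall j, s < r j /\ s < 1 - r j) ->
  jump e r i b u g -> in_arc s u -> in_arc s g.
Proof.
move=> s0 sr [ui Cu gi J] arc; right.
suff [c [/andP[c0 cs] cu]] : exists c, 0 <= c <= s /\ forall j, u j <= c \/ 1 - s + c <= u j.
  exists c; split; first by rewrite c0.
  move=> j; have [->|ji] := eqVneq j i; first by left; rewrite gi.
  have [? ?] := sr j; move: (J j ji) (cu j); case: ifP => _; last by move=> ->.
  by case=> -[? ->] [?|?]; [left|left|right|right]; lra.
case: arc => [[a az]|//]; exists 0; split; first by apply/andP; split; lra.
by move=> j; right; have := az j; have := az i; rewrite ui; lra.
Qed.

Lemma enorm_ge (z : @state R N) i : `|z i| <= enorm z.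
Proof.
rewrite -sqrtr_sqr; apply: ler_wsqrtr; rewrite (bigD1 i) //= lerDl.
by apply: sumr_ge0 => j _; exact: sqr_ge0.
Qed.

Lemma enorm_le (z : @state R N) s : 0 <= s -> (forall i, `|z i| <= s) -> enorm z <= N%:R * s.
Proof.
move=> s0 zs; have Ns : 0 <= N%:R * s by rewrite mulr_ge0.
rewrite -(ger0_norm Ns) -sqrtr_sqr; apply: ler_wsqrtr.
apply: (@le_trans _ _ (\sum_(i < N) s ^+ 2)).
  by apply: ler_sum => i _; rewrite -real_normK ?num_real // lerXn2r ?nnegrE.
rewrite sumr_const card_ord exprMn -[X in X <= _]mulr_natl; apply: ler_wpM2r; first exact: sqr_ge0.
by rewrite -natrX ler_nat; case: (N) N0 => // n _; rewrite expnS expn1 leq_pmulr.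
Qed.

Lemma nbhd_cl_in_arc dl z : nbhd_cl dl z -> in_arc (2 * dl) z.
Proof.
move=> [a [Aa h]].
have {}h i : `|z i - a i| <= dl by apply: le_trans h; exact: (enorm_ge (fun i => z i - a i)).
have d0 : 0 <= dl by apply: le_trans (h (Ordinal N0)).
case: Aa => [[m [_ aE]]|a01].
  left; exists (m - dl) => i; move: (h i); rewrite aE ler_norml => /andP[? ?].
  by apply/andP; split; lra.
right; exists dl; split; first by apply/andP; split; lra.
move=> i; move: (h i); case: (a01 i) => ->; rewrite ler_norml => /andP[? ?];
  by [left; lra|right; lra].
Qed.

Lemma in_arc_nbhd_op s eps z : 0 <= s -> N%:R * s < eps -> Cset z -> in_arc s z ->
  nbhd_op eps z.
Proof.
move=> s0 se Cz [[a az]|[b [/andP[b0 bs] bz]]].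
  exists (fun=> z (Ordinal N0)); split.
    by left; exists (z (Ordinal N0)).
  apply: le_lt_trans (enorm_le s0 _) se => i.
  by have := az i; have := az (Ordinal N0); rewrite ler_norml => *; apply/andP; split; lra.
exists (fun i => if z i <= b then 0 else 1); split.
  by right => i; case: ifP; [left|right].
apply: le_lt_trans (enorm_le s0 _) se => i; have /andP[? ?] := Cz i.
rewrite ler_norml; case: ifPn => [?|]; first by apply/andP; split; lra.
by case: (bz i) => [->//|? _]; apply/andP; split; lra.
Qed.

(** Inside the cube the synchronization set consists of the arcs of length 0, so its invariance is a
    case of that of short arcs. *)
Lemma Async_in_arc z : Async z -> in_arc 0 z.
Proof.
case=> [[m [_ ->]]|z01]; first by left; exists m => i; rewrite addr0 lexx.
right; exists 0; split; first by rewrite lexx.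
by move=> i; case: (z01 i) => ->; [left|right]; lra.
Qed.

Lemma in_arc_Async z : Cset z -> in_arc 0 z -> Async z.
Proof.
move=> Cz [[a az]|[b [/andP[b0 bs] bz]]].
  left; exists (z (Ordinal N0)); split; first exact: Cz.
  by apply/funext => i; have := az i; have := az (Ordinal N0) => *; apply: le_anti; lra.
right => i; have /andP[? ?] := Cz i.
by case: (bz i) => ?; [left|right]; apply: le_anti; apply/andP; split; lra.
Qed.

Context {x : @harc R N} {xi : @state R N} {om : nat -> @edges N}.
Context (H : is_hsol e r T x xi om).
Context (Cxi : Cset xi).

Lemma hsol_in_arc s t0 k0 t k : 0 <= s -> (forall j, s < r j /\ s < 1 - r j) ->
  hdom x (t0, k0) -> in_arc s (hval x t0 k0) ->
  hdom x (t, k) -> t0 <= t -> (k0 <= k)%N -> in_arc s (hval x t k).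
Proof.
move=> s0 sr d0 a0; apply: (hsol_ind T0 (Q := fun t k => in_arc s (hval x t k)) H d0 a0) => [u v k' _ uv du dv IH|u k' _ du dv IH].
  have E : hval x v k' = fun i => hval x u k' i + (v - u) / T.
    by apply/funext => i; exact: (hsol_affine H).
  rewrite E; apply: in_arc_flow => //; first by rewrite divr_ge0 ?subr_ge0 // ltW.
    exact: (hsol_Cset T0 H Cxi du).
  by rewrite -E; exact: (hsol_Cset T0 H Cxi dv).
by have [i J] := hsol_jump H du dv; exact: in_arc_jump J IH.
Qed.

Lemma hsol_Async_stays t0 k0 t k : hdom x (t0, k0) -> Async (hval x t0 k0) ->
  hdom x (t, k) -> t0 <= t -> (k0 <= k)%N -> Async (hval x t k).
Proof.
move=> d0 /Async_in_arc a0 dt tt kk; apply: in_arc_Async.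
  exact: (hsol_Cset T0 H Cxi dt).
apply: (hsol_in_arc _ _ d0 a0) => // j; by have := r01 j; split; lra.
Qed.

End Stability.

(** * Staircase arcs *)

Section Graphs.
Set Implicit Arguments. Unset Strict Implicit.
Context {R : realType} {N : nat}.
Implicit Types (x y : @harc R N).

Lemma hgraphP x t k u : hgraph x (t, k%:R, u) <-> hdom x (t, k) /\ u = hval x t k.
Proof.
split=> [[t' [k' [d [-> /eqP + ->]]]]|[d ->]]; last by exists t, k.
by rewrite eqr_nat => /eqP->.
Qed.

Lemma hgraph_leP x K t k u :
  hgraph_le x K (t, k%:R, u) <-> [/\ hdom x (t, k), (k <= K)%N & u = hval x t k].
Proof.
split=> [[t' [k' [d kK [-> /eqP + ->]]]]|[d kK ->]]; last by exists t, k.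
by rewrite eqr_nat => /eqP->.
Qed.

Lemma sub_hgraph_extends x y : hgraph x `<=` hgraph y -> extends x y.
Proof.
move=> xy; split=> [[t k] d|t k d].
  by have /hgraphP[] : hgraph y (t, k%:R, hval x t k) by apply: xy; exact/hgraphP.
by have /hgraphP[] : hgraph y (t, k%:R, hval x t k) by apply: xy; exact/hgraphP.
Qed.

Lemma extends_sub_hgraph x y : extends x y -> hgraph x `<=` hgraph y.
Proof.
move=> [dxy vxy] _ [t [k [d ->]]]; apply/hgraphP; split; first exact: dxy.
by rewrite vxy.
Qed.

Lemma hgraph_le_bounded x K : (forall t k, hdom x (t, k) -> (k <= K)%N) ->
  hgraph x = hgraph_le x K.
Proof.
move=> b; apply/seteqP; split=> q [t [k]].
  by move=> [d ->]; apply/hgraph_leP; split => //; exact: b d.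
by move=> [d _ ->]; exact/hgraphP.
Qed.

End Graphs.

Section Stairs.
Set Implicit Arguments. Unset Strict Implicit.
Context {R : realType} {N : nat} {e : rel 'I_N} {r : 'I_N -> R} {T : R} (T0 : 0 < T).
Context (J : nat) (ts : nat -> R) (z : nat -> @state R N).

(** Every explicit solution has this shape: [J] jumps, the [k]-th flow piece starting from [z k] at
    time [ts k]. *)
Definition stair : @harc R N :=
  HArc [set q | (q.2 <= J)%N /\ ts q.2 <= q.1 <= ts q.2.+1]
       (fun t k i => z k i + (t - ts k) / T).

Lemma stair_closed : closed_tri (hgraph stair).
Proof.
move=> [[t y] u] /= nin; apply: contrapT => /forallNP noeps; apply: nin.
pose Q (k : 'I_J.+1) eps := exists t', [/\ ts k <= t' <= ts k.+1, `|t' - t| < eps,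
  `|k%:R - y| < eps & forall i, `|hval stair t' k i - u i| < eps].
have [||k Qk] := @eps_pigeonhole _ _ Q.
- move=> k a b ab [t' [h1 h2 h3 h4]]; exists t'; split => //.
  + exact: lt_le_trans h2 ab.
  + exact: lt_le_trans h3 ab.
  + by move=> i; exact: lt_le_trans (h4 i) ab.
- move=> eps e0; have := noeps eps => /not_andP[//|] /existsNP[z'].
  move=> /not_implyP[h1] /not_implyP[h2] /not_implyP[h3] /contrapT.
  move=> [t' [k [[/= kJ tt] zE]]]; rewrite zE /= in h1 h2 h3.
  by exists (Ordinal (kJ : (k < J.+1)%N)), t'; split.
have yE : y = k%:R by apply/esym/eq_eps => eps /Qk[t' []].
have tk : ts k <= t <= ts k.+1.
  apply/andP; split; apply: le_eps => eps /Qk[t' [/andP[a b]]];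
    by rewrite ltr_norml => /andP[? ?] _ _; lra.
rewrite yE; apply/hgraphP; split; first by split => //=; rewrite -ltnS.
apply/funext => i; apply/eq_eps => eps e0.
have V0 : 0 < T^-1 by rewrite invr_gt0.
have e2 : 0 < eps / 2 by lra.
(* Clocks have slope [1 / T], so a time error below [eps / 2 * T] moves a clock by less than
   [eps / 2]. *)
have e1 : 0 < Num.min (eps / 2) (eps / 2 * T) by rewrite lt_min e2 mulr_gt0.
have [t' [_ + _ /(_ i) /=]] := Qk _ e1.
rewrite !lt_min => /andP[_ h1] /andP[h2 _].
have h3 : `|(t' - t) / T| < eps / 2 by rewrite normrM (gtr0_norm V0) ltr_pdivrMr.
rewrite (_ : u i - _ = (t' - t) / T - (z k i + (t' - ts k) / T - u i)); last lra.
by apply: le_lt_trans (ler_normB _ _) _; lra.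
Qed.

Context (ts0 : ts 0%N = 0) (mono : forall k, (k <= J)%N -> ts k <= ts k.+1).

Let ts_mono a b : (a <= b)%N -> (b <= J.+1)%N -> ts a <= ts b.
Proof.
elim: b => [|b IH]; first by rewrite leqn0 => /eqP->.
rewrite leq_eqVlt => /orP[/eqP->//|ab bk].
by apply: le_trans (IH ab (ltnW bk)) _; apply: mono.
Qed.

Lemma stair_htd : is_htd (hdom stair).
Proof.
split=> [[t k] [/= kJ /andP[tk _]]|t J' [/= JJ /andP[tJ1 tJ2]]].
  by apply: le_trans tk; rewrite -ts0; apply: ts_mono => //; apply: leqW.
exists (fun k => if (k <= J')%N then ts k else t); split.
- by rewrite leq0n.
- move=> k kJ'; rewrite kJ'; case: ltnP => [?|J'k]; first by apply: mono; exact: leq_trans JJ.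
  by rewrite (_ : k = J') //; apply/eqP; rewrite eqn_leq kJ'.
- by rewrite ltnn.
move=> s k /=; split=> [[[kJ /andP[s1 s2]] [st kJ']]|[kJ']]; rewrite kJ'.
  by split => //; split => //; case: ifP.
move=> [s1 s2]; have kJ := leq_trans kJ' JJ.
case: ltnP s2 => [kJ2 s2|J'k st].
  split; first by split => //; apply/andP.
  by split => //; apply: le_trans s2 _; apply: le_trans tJ1; apply: ts_mono => //; exact: leqW.
have kE : k = J' by apply/eqP; rewrite eqn_leq kJ'.
by subst k; split => //; split => //; apply/andP; split => //; exact: le_trans tJ2.
Qed.

Lemma affine_abs_cont (c a : R) (I : set R) : loc_abs_cont (fun t => c + (t - a) / T) I.
Proof.
move=> a0 b0 _ _ eps e0; exists (eps * T); split; first exact: mulr_gt0.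
move=> n a_ b_ ab _; rewrite -ltr_pdivrMr // mulr_suml; apply: le_lt_trans.
apply: ler_sum => k _; have [_ [h _]] := ab k.
rewrite [X in `|X|](_ : _ = (b_ k - a_ k) / T); last by rewrite /=; lra.
by rewrite ger0_norm // divr_ge0 ?subr_ge0 // ltW.
Qed.

Lemma affine_is_derive (c a t : R) : is_derive t 1 (fun s : R => c + (s - a) / T) T^-1.
Proof.
have -> : (fun s : R => c + (s - a) / T) = cst (c - a / T) + (T^-1 \*: id).
  by apply/funext => s; rewrite !fctE /= /GRing.scale /= mulrBl [s / T]mulrC addrA addrAC.
apply: is_derive_eq (is_deriveD (is_derive_cst _ _ _) (is_deriveZ _ (is_derive_id _ _))) _.
by rewrite add0r /GRing.scale /= mulr1.
Qed.

Context (xi : @state R N) (om : nat -> @edges N) (z0 : z 0%N = xi).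
Let zend k i := z k i + (ts k.+1 - ts k) / T.
Context (flowC : forall k, (k <= J)%N -> ts k < ts k.+1 -> Cset (z k) /\ Cset (zend k)).
Context (jumpC : forall k, (k < J)%N -> Dset (zend k) /\ GS e r (zend k) (om k) (z k.+1)).

(** Clocks increase during flow, so it is enough that both ends of a flow piece lie in the cube. *)
Lemma stair_hsol : is_hsol e r T stair xi om.
Proof.
split.
- split; first exact: stair_htd.
  by move=> k i; exact: affine_abs_cont.
- by split => //=; rewrite ts0 lexx -ts0 mono.
- by apply/funext => i /=; rewrite ts0 subrr mul0r addr0 z0.
- move=> t k [eps [e0 flow]]; split; last by move=> i; exact: affine_is_derive.
  have [/= kJ /andP[_ h2]] : hdom stair (t + eps / 2, k).
    by apply: flow; rewrite addrC addKr gtr0_norm; lra.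
  have [_ /andP[/= h1 _]] : hdom stair (t - eps / 2, k).
    by apply: flow; rewrite addrC addKr normrN gtr0_norm; lra.
  have [|C1 C2] := flowC kJ; first lra.
  move=> i; have /andP[lo _] := C1 i; have /andP[_ hi] := C2 i.
  have V0 : 0 < T^-1 by rewrite invr_gt0.
  have p1 : 0 <= (t - ts k) / T by rewrite divr_ge0 ?ltW //; lra.
  have p2 : 0 <= (ts k.+1 - t) / T by rewrite divr_ge0 ?ltW //; lra.
  by move: hi; rewrite /zend => hi; apply/andP; split => /=; lra.
- move=> t k [_ /andP[_ /= h1]] [/= kJ /andP[h2 _]].
  have tE : t = ts k.+1 by apply: le_anti; rewrite h1 h2.
  have -> : (fun i => z k i + (t - ts k) / T) = zend k by rewrite tE.
  have -> : (fun i => z k.+1 i + (t - ts k.+1) / T) = z k.+1.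
    by apply/funext => i; rewrite tE subrr mul0r addr0.
  exact: jumpC.
Qed.

End Stairs.

(** * Causality and existence of random solutions *)

Section RandomSolutions.
Set Implicit Arguments. Unset Strict Implicit.
Context {R : realType} {N : nat} {e : rel 'I_N} {r : 'I_N -> R} {T : R}.
Context (r01 : forall j, 0 < r j < 1) (T0 : 0 < T).
Context {d : measure_display} {Omega : measurableType d} (om : nat -> Omega -> @edges N).
Context (om_meas : forall k phi, measurable [set w | om k w = phi]).
Implicit Types (X Y : Omega -> @harc R N) (xi : @state R N).

Definition agree K (w w' : Omega) := forall i, (i < K)%N -> om i w = om i w'.

(** Replaces both measurability requirements on a random solution; the passage in each direction is
    [rand_sol_causal] and [causal_rand_sol]. *)
Definition causal X := forall K w w', agree K w w' -> hgraph_le (X w) K = hgraph_le (X w') K.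

Lemma agree_sym K w w' : agree K w w' -> agree K w' w.
Proof. by move=> h i /h. Qed.

Lemma agree_trans K w w' w'' : agree K w w' -> agree K w' w'' -> agree K w w''.
Proof. by move=> h h' i iK; rewrite h // h'. Qed.

Lemma agree_le K M w w' : (K <= M)%N -> agree M w w' -> agree K w w'.
Proof. by move=> KM h i iK; apply: h; exact: leq_trans KM. Qed.

Lemma causal_dom X K w w' t k : causal X -> agree K w w' -> (k <= K)%N ->
  hdom (X w) (t, k) -> hdom (X w') (t, k) /\ hval (X w') t k = hval (X w) t k.
Proof.
move=> cX /cX E kK dt.
have : hgraph_le (X w) K (t, k%:R, hval (X w) t k) by apply/hgraph_leP.
by rewrite E => /hgraph_leP[].
Qed.

(** The graph of [X w'] is closed, so its complement is an admissible open test set. A point of the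
    truncated graph of [X w] missing from that graph would make the test distinguish [w] from [w'],
    which have the same first [K] draws. *)
Lemma rand_sol_causal X xi : rand_sol om e r T X xi -> causal X.
Proof.
move=> [_ clX measX _].
suff half K w w' : agree K w w' -> hgraph_le (X w) K `<=` hgraph_le (X w') K.
  by move=> K w w' a; apply/seteqP; split; apply: half => //; exact: agree_sym.
move=> a _ [t [k [dt kK ->]]].
suff : hgraph (X w') (t, k%:R, hval (X w) t k) by move=> /hgraphP[? ?]; apply/hgraph_leP.
apply: contrapT => nin.
have [B BE] := measX K _ (clX w').
have : [set w | hgraph_le (X w) K `&` ~` hgraph (X w') !=set0] w.
  by exists (t, k%:R, hval (X w) t k); split => //; apply/hgraph_leP.
rewrite BE /= => Bw.
have : [set w | B (fun k : 'I_K => om k w)] w'.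
  by rewrite /= (_ : (fun k : 'I_K => _) = (fun k : 'I_K => om k w)) //; apply/funext => i; rewrite a.
rewrite -BE => -[q [+ nq]]; move=> [t' [k' [d' _ qE]]]; apply: nq; rewrite qE.
exact/hgraphP.
Qed.

(** The first [K] draws take finitely many values, so such a set is a finite union of cylinders. *)
Lemma agree_measurable K (A : set Omega) :
  (forall w w', agree K w w' -> A w -> A w') -> measurable A.
Proof.
move=> hA.
pose F (f : {ffun 'I_K -> @edges N}) := \bigcap_(i in [set: 'I_K]) [set w | om i w = f i].
have -> : A = \bigcup_(f in [set f | exists2 w, A w & F f w]) F f.
  apply/seteqP; split=> w.
    move=> Aw; exists [ffun i : 'I_K => om i w]; last by move=> i _; rewrite /= ffunE.
    by exists w => // i _; rewrite /= ffunE.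
  move=> [f [w' Aw' Fw'] Fw]; apply: hA Aw' => i iK.
  by have /= -> := Fw' (Ordinal iK) I; have /= -> := Fw (Ordinal iK) I.
apply: fin_bigcup_measurable => [|f _]; first exact: finite_finset.
by apply: fin_bigcap_measurable => // i _; exact: om_meas.
Qed.

Lemma causal_rand_sol X xi : causal X -> (forall w, closed_tri (hgraph (X w))) ->
  (forall w, is_hsol e r T (X w) xi (fun k => om k w)) -> rand_sol om e r T X xi.
Proof.
move=> cX clX hX.
have sv K O w w' : agree K w w' -> (hgraph_le (X w) K `&` O !=set0) ->
    (hgraph_le (X w') K `&` O !=set0) by move=> /cX->.
split=> //; [move=> O _|move=> K O _].
  rewrite (_ : [set w | _] = \bigcup_K [set w | hgraph_le (X w) K `&` O !=set0]).
    by apply: bigcup_measurable => K _; apply: (agree_measurable (K := K)) => w w'; exact: sv.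
  apply/seteqP; split=> w.
    move=> [q [[t [k [dt qE]]] Oq]]; exists k => //; exists q; split => //.
    by rewrite qE; apply/hgraph_leP.
  move=> [k _ [q [[t [k' [dt _ qE]]] Oq]]]; exists q; split => //.
  by rewrite qE; apply/hgraphP.
exists [set f | exists2 w, f = (fun k : 'I_K => om k w) & hgraph_le (X w) K `&` O !=set0].
apply/seteqP; split=> w; first by exists w.
move=> [w' E]; apply: sv => i iK.
by have := congr1 (fun f => f (Ordinal iK)) E.
Qed.

Lemma max1_Dset (u : @state R N) i : Cset u -> u i = 1 -> Dset u.
Proof.
move=> Cu ui; split => //; apply: le_anti; apply/andP; split.
  by apply: bigmax_le => // j _; case/andP: (Cu j).
by rewrite -ui; exact: le_bigmax.
Qed.

Lemma rand_sol_exists xi : Cset xi ->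
  exists X, rand_sol om e r T X xi /\ forall w, nontrivial (X w).
Proof.
move=> Cxi; have [[i xii]|no1] := pselect (exists i, xi i = 1).
  (* The jump value is selected as a function of the first draw alone, which makes the solution
     causal. *)
  have [g gP] := choice (fun E => @GS_total _ _ e r xi E i r01 Cxi xii).
  have z0 (z : @state R N) : (fun i => z i + (0 - 0) / T) = z.
    by apply/funext => j; rewrite subrr mul0r addr0.
  exists (fun w => stair (T := T) 1 (fun=> 0) (fun k => if k is 0%N then xi else g (om 0%N w))).
  split; last first.
    move=> w; exists (0, 0%N), (0, 1%N).
    by split; [|split] => //=; rewrite lexx.
  apply: causal_rand_sol => [K w w' a|w|w].
  - have zE k : (k <= K)%N -> (if k is 0%N then xi else g (om 0%N w)) =
                              (if k is 0%N then xi else g (om 0%N w')).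
      by case: k => // k kK; rewrite a // (leq_trans _ kK).
    by apply/seteqP; split=> _ [t [k [dt kK ->]]]; apply/hgraph_leP; split => //=; rewrite zE.
  - exact: stair_closed.
  - apply: stair_hsol => //; first by move=> k; rewrite ltxx.
    by case=> // _; rewrite z0; split; [exact: max1_Dset Cxi xii|exact: gP].
have [|m [/andP[m0 m1] mxi]] := @ord_min_gt0 _ N (fun j => 1 - xi j).
  move=> j; rewrite subr_gt0 lt_neqAle; case/andP: (Cxi j) => _ ->; rewrite andbT.
  by apply/eqP => ?; apply: no1; exists j.
have mT : 0 < m * T by rewrite mulr_gt0.
exists (fun w => stair (T := T) 0 (fun k => if k is 0%N then 0 else m * T) (fun=> xi)); split.
  apply: causal_rand_sol => [//|w|w]; first exact: stair_closed.
  apply: stair_hsol => //; first by case=> //= _; exact: ltW.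
  case=> //= _ _; split => // j; rewrite subr0 mulfK ?gt_eqF //.
  by have := mxi j; have /andP[? ?] := Cxi j => ?; apply/andP; split; lra.
move=> w; exists (0, 0%N), (m * T, 0%N); split; first by rewrite /= lexx ltW.
split; first by rewrite /= lexx ltW.
by move=> -[] E; rewrite -E ltxx in mT.
Qed.

End RandomSolutions.

(** * Completeness of maximal random solutions *)

Section Maximality.
Set Implicit Arguments. Unset Strict Implicit.
Context {R : realType} {N : nat} {e : rel 'I_N} {r : 'I_N -> R} {T : R}.
Context (r01 : forall j, 0 < r j < 1) (T0 : 0 < T).

(** Closedness of the graph puts the supremum of the times at the largest jump index into the
    domain. *)
Lemma hsol_last_point x xi om : @is_hsol R N e r T x xi om -> closed_tri (hgraph x) ->
  ~ complete x -> exists t k, hdom x (t, k) /\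
    forall t' k', hdom x (t', k') -> t' <= t /\ (k' <= k)%N.
Proof.
move=> H cl /existsNP[M nM].
have bnd t k : hdom x (t, k) -> t + k%:R <= M.
  by move=> dt; rewrite leNgt; apply/negP => lt; apply: nM; exists t, k.
pose p k := `[< exists t, hdom x (t, k) >].
have p0 : exists k, p k by exists 0%N; apply/asboolP; exists 0; exact: hsol_dom00 H.
have pM k : p k -> (k <= Num.truncn M)%N.
  move=> /asboolP[t dt]; have := bnd _ _ dt; have := hsol_dom_ge0 H dt => t0 tk.
  have kM : k%:R <= M by lra.
  by rewrite truncn_ge_nat // (le_trans _ kM).
case: (ex_maxnP p0 pM) => k /asboolP[t0 dt0] kmax.
pose S := [set t | hdom x (t, k)].
have ubS : ubound S M.
  by move=> t /bnd; have : (0 : R) <= k%:R by []; lra.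
have supS : has_sup S by split; [exists t0|exists M].
pose t := sup S.
have lt t' : hdom x (t', k) -> t' <= t by move=> h; apply: (ub_le_sup (proj2 supS)).
have dt : hdom x (t, k).
  pose u : @state R N := fun i => hval x t0 k i + (t - t0) / T.
  suff /hgraphP[] : hgraph x (t, k%:R, u) by [].
  apply: contrapT => /cl[eps [e0 far]].
  have V0 : 0 < T^-1 by rewrite invr_gt0.
  pose dl := Num.min eps (eps * T).
  have dl0 : 0 < dl by rewrite lt_min e0 mulr_gt0.
  have [t1 dt1 t1t] := sup_adherent dl0 supS.
  pose t2 := Num.max t0 t1.
  have dt2 : hdom x (t2, k) by rewrite /t2; case: leP.
  have tt2 : 0 <= t - t2 by rewrite subr_ge0 lt.
  have near : t - t2 < dl.
    have ? : t1 <= t2 by rewrite /t2 le_max lexx orbT.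
    by have : t - dl < t1 := t1t; lra.
  apply: (far (t2, k%:R, hval x t2 k)); last exact/hgraphP.
  - by rewrite /= distrC ger0_norm //; apply: lt_le_trans near _; rewrite ge_min lexx.
  - by rewrite subrr normr0.
  move=> i /=; rewrite (hsol_affine H i dt0 dt2); last by rewrite /t2 le_max lexx.
  rewrite (_ : _ - u i = - ((t - t2) / T)); last by rewrite /u; lra.
  rewrite normrN ger0_norm; last by rewrite divr_ge0 // ltW.
  by rewrite ltr_pdivrMr //; apply: lt_le_trans near _; rewrite ge_min lexx orbT.
exists t, k; split => // t' k' d'.
have k'k : (k' <= k)%N by apply: kmax; apply/asboolP; exists t'.
split => //; move: k'k; rewrite leq_eqVlt => /orP[/eqP kE|k'k]; first by subst k'; exact: lt.
exact: (hsol_dom_le T0 H d' dt k'k).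
Qed.

Context {d : measure_display} {Omega : measurableType d} {om : nat -> Omega -> @edges N}.
Context (om_meas : forall k phi, measurable [set w | om k w = phi]).

(* Changing [X] only on the cylinder of sample points that agree with [w0] up to [M] keeps
   causality as long as the new arc is the old one before jump [M]. *)
Lemma rand_sol_splice X xi w0 M Z : rand_sol om e r T X xi ->
  closed_tri (hgraph Z) ->
  (forall w, agree om M w w0 -> is_hsol e r T Z xi (fun k => om k w)) ->
  (forall w, agree om M w w0 -> forall t k, hdom (X w) (t, k) -> (k <= M)%N) ->
  (forall K, (K < M)%N -> hgraph_le Z K = hgraph_le (X w0) K) ->
  hgraph (X w0) `<=` hgraph Z -> hdom (X w0) <> hdom Z ->
  exists Y, rand_sol om e r T Y xi /\ (forall w, extends (X w) (Y w)) /\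
            exists w, hdom (X w) <> hdom (Y w).
Proof.
move=> RX clZ hZ bX low sub neq.
have cX := rand_sol_causal RX; case: RX => _ clX _ hX.
have gX w : agree om M w w0 -> hgraph (X w) = hgraph (X w0).
  move=> a; rewrite (hgraph_le_bounded (bX w a)) (hgraph_le_bounded (bX w0 _)) //.
  exact: cX.
exists (fun w => if pselect (agree om M w w0) then Z else X w); split; last split.
- apply: (causal_rand_sol om_meas) => [K w w' a|w|w]; last 2 first.
  + by case: pselect => a; [exact: clZ|exact: clX].
  + by case: pselect => a; [exact: hZ|exact: hX].
  have [MK|KM] := leqP M K.
    have a' := agree_le MK a.
    case: pselect => [aw|naw]; case: pselect => [aw'|naw'] //.
    + by case: naw'; exact: agree_trans (agree_sym a') aw.
    + by case: naw; exact: agree_trans a' aw'.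
    + exact: cX.
  have E v : hgraph_le (if pselect (agree om M v w0) then Z else X v) K = hgraph_le (X v) K.
    case: pselect => // av; rewrite low //; apply: cX; apply: agree_sym.
    exact: agree_le (ltnW KM) av.
  by rewrite !E; exact: cX.
- move=> v; case: pselect => a; last by split.
  by apply: sub_hgraph_extends; rewrite gX.
- by exists w0; case: pselect => // -[].
Qed.

Lemma rand_sol_extend X xi w0 : Cset xi -> rand_sol om e r T X xi -> ~ complete (X w0) ->
  exists Y, rand_sol om e r T Y xi /\ (forall w, extends (X w) (Y w)) /\
            exists w, hdom (X w) <> hdom (Y w).
Proof.
move=> Cxi RX nc; have cX := rand_sol_causal RX.
have [_ clX _ hX] := RX; have H := hX w0.
have [t [k [dt tkmax]]] := hsol_last_point H (clX w0) nc.
have [ts [ts0 mono tsk E]] : exists ts : nat -> R,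
    [/\ ts 0%N = 0, (forall j, (j <= k)%N -> ts j <= ts j.+1), ts k.+1 = t &
     forall s j, hdom (X w0) (s, j) <-> (j <= k)%N /\ ts j <= s <= ts j.+1].
  case: (H) => -[[_ htd] _] _ _ _ _; have [ts [? ? ? E]] := htd _ _ dt.
  exists ts; split => // s j; split=> [ds|[jk /andP[s1 s2]]].
    have [st jk] := tkmax _ _ ds.
    by have [_ [s1 s2]] := (E s j).1 (conj ds (conj st jk)); rewrite s1 s2.
  by have [] := (E s j).2 (conj jk (conj s1 s2)).
pose z j := hval (X w0) (ts j) j.
have dts j : (j <= k)%N -> hdom (X w0) (ts j, j) by move=> jk; apply/E; rewrite lexx mono.
have dts1 j : (j <= k)%N -> hdom (X w0) (ts j.+1, j) by move=> jk; apply/E; rewrite lexx mono.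
have val s j : hdom (X w0) (s, j) -> hval (X w0) s j = fun i => z j i + (s - ts j) / T.
  move=> ds; have [jk /andP[js _]] := (E s j).1 ds.
  by apply/funext => i; exact: (hsol_affine H i (dts _ jk) ds js).
have Cv s j : hdom (X w0) (s, j) -> Cset (hval (X w0) s j) by move=> ds; exact: (hsol_Cset T0 H Cxi ds).
have z0 : z 0%N = xi by rewrite /z ts0; case: H.
have jmpC j w : (j < k)%N -> om j w = om j w0 ->
    Dset (fun i => z j i + (ts j.+1 - ts j) / T) /\
    GS e r (fun i => z j i + (ts j.+1 - ts j) / T) (om j w) (z j.+1).
  move=> jk ->; rewrite -val; last exact: dts1 (ltnW jk).
  by case: (H) => _ _ _ _; apply; [exact: dts1 (ltnW jk)|exact: dts].
have [[i ti]|no1] := pselect (exists i, hval (X w0) t k i = 1).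
  have [g gP] := @GS_total _ _ e r _ (om k w0) i r01 (Cv _ _ dt) ti.
  pose ts' j := if (j <= k.+1)%N then ts j else t.
  pose z' j := if (j <= k)%N then z j else g.
  have dZ s j : (j <= k)%N -> hdom (stair (T := T) k.+1 ts' z') (s, j) <-> hdom (X w0) (s, j).
    move=> jk; rewrite /= /ts' ltnS (leqW jk) jk E jk.
    by split=> -[].
  have vZ s j : hdom (X w0) (s, j) -> hval (stair (T := T) k.+1 ts' z') s j = hval (X w0) s j.
    by move=> ds; have [jk _] := (E s j).1 ds; rewrite (val _ _ ds) /= /z' /ts' jk leqW.
  (* The appended jump uses the draw [om k], so the cylinder fixes [k.+1] draws. *)
  apply: (rand_sol_splice (w0 := w0) (M := k.+1) (Z := stair (T := T) k.+1 ts' z') RX).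
  - exact: stair_closed.
  - move=> w a; apply: stair_hsol => //.
    + move=> j jk1; rewrite /ts' jk1; case: ifPn => [?|]; first by rewrite mono.
      by rewrite -ltnNge ltnS => ?; rewrite (_ : j = k.+1) ?tsk //; apply/eqP; rewrite eqn_leq jk1.
    + move=> j jk1; rewrite /ts' jk1; case: ifPn => [jk _|]; last first.
        by rewrite -ltnNge ltnS => ?; rewrite (_ : j = k.+1) ?tsk ?ltxx //; apply/eqP; rewrite eqn_leq jk1.
      rewrite /z' -ltnS jk; split; first exact: Cv (dts _ _).
      by rewrite -val; [apply: Cv; exact: dts1|exact: dts1].
    + move=> j; rewrite ltnS /ts' /z' => jk; rewrite ltnS jk (leqW jk).
      case: ltnP => jk'; first by apply: jmpC => //; rewrite a.
      have jE : j = k by apply/eqP; rewrite eqn_leq jk.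
      subst j; rewrite -val; last exact: dts1.
      by rewrite tsk a //; split => //; exact: (max1_Dset (Cv _ _ dt) ti).
  - move=> w a s j ds; rewrite leqNgt; apply/negP => jk.
    have [s' [_ ds' _]] := hsol_dom_jump (hX w) ds jk.
    have [ds0 _] := causal_dom cX a (leqnn _) ds'.
    by have [_] := tkmax _ _ ds0; rewrite ltnn.
  - move=> K Kk; apply/seteqP; split=> _ [s [j [ds jK ->]]]; apply/hgraph_leP; split => //.
    + by apply/dZ => //; exact: leq_trans jK Kk.
    + by rewrite vZ //; apply/dZ => //; exact: leq_trans jK Kk.
    + by apply/dZ => //; exact: leq_trans jK Kk.
    + by rewrite vZ.
  - apply: extends_sub_hgraph; split=> [[s j] ds|]; last exact: vZ.
    by apply/dZ => //; case: (tkmax _ _ ds).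
  - move=> dE; have : hdom (X w0) (t, k.+1).
      by rewrite dE /= /ts' leqnn tsk ltnn lexx.
    by move=> /tkmax[_]; rewrite ltnn.
have [|m [/andP[m0 m1] mxi]] := @ord_min_gt0 _ N (fun j => 1 - hval (X w0) t k j).
  move=> j; rewrite subr_gt0 lt_neqAle; case/andP: (Cv _ _ dt j) => _ ->; rewrite andbT.
  by apply/eqP => ?; apply: no1; exists j.
have mT : 0 < m * T by rewrite mulr_gt0.
pose ts' j := if (j <= k)%N then ts j else t + m * T.
have vZ s j : hdom (X w0) (s, j) -> hval (stair (T := T) k ts' z) s j = hval (X w0) s j.
  by move=> ds; have [jk _] := (E s j).1 ds; rewrite (val _ _ ds) /= /ts' jk.
have dZ s j : (j < k)%N -> hdom (stair (T := T) k ts' z) (s, j) <-> hdom (X w0) (s, j).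
  by move=> jk; rewrite /= /ts' jk (ltnW jk) E (ltnW jk); split=> -[].
have last j : (j <= k)%N -> (j < k)%N = false -> j = k.
  by move=> jk h; apply/eqP; rewrite eqn_leq jk leqNgt h.
have tskt : ts k <= t by rewrite -tsk mono.
(* Further flow uses no new draw, so the cylinder fixes [k] draws. *)
apply: (rand_sol_splice (w0 := w0) (M := k) (Z := stair (T := T) k ts' z) RX).
- exact: stair_closed.
- move=> w a; apply: stair_hsol => //.
  + move=> j jk; rewrite /ts' jk; case: ifPn => [?|/negbTE/(last _ jk) ->]; first by rewrite mono.
    by rewrite (le_trans tskt) // lerDl ltW.
  + move=> j jk; rewrite /ts' jk; split; first exact: Cv (dts _ jk).
    case: ifPn => [jk'|/negbTE/(last _ jk) jE].
      by rewrite -val; [apply: Cv; exact: dts1|exact: dts1].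
    subst j => i; have := congr1 (fun f => f i) (val _ _ dt) => /= vE.
    rewrite (_ : _ + _ = hval (X w0) t k i + m); last first.
      have -> : t + m * T - ts k = t - ts k + m * T by lra.
      by rewrite vE mulrDl mulfK ?gt_eqF // addrA.
    by have := mxi i; have /andP[? ?] := Cv _ _ dt i => ?; apply/andP; split; lra.
  + move=> j jk; rewrite /ts' (ltnW jk) jk; apply: jmpC => //; exact: a.
(* If [X w] jumped once more, it would do so with a clock at 1 at some time up to [t]; the arc of
   [w0] shares this state, so it would have a clock at 1 at time [t]. *)
- move=> w a s j ds; rewrite leqNgt; apply/negP => jk.
  have [s' [_ ds' ds1]] := hsol_dom_jump (hX w) ds jk.
  have [ds0 vE] := causal_dom cX a (leqnn _) ds'.
  have [i [ui _ _ _]] := hsol_jump (hX w) ds' ds1.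
  have [s't _] := tkmax _ _ ds0.
  apply: no1; exists i; apply: le_anti.
  have /andP[_ ->] := Cv _ _ dt i; rewrite (hsol_affine H i ds0 dt s't) vE ui lerDl.
  by rewrite divr_ge0 ?subr_ge0 // ltW.
- move=> K Kk; apply/seteqP; split=> _ [s [j [ds jK ->]]]; apply/hgraph_leP; split => //.
  + by apply/dZ => //; exact: leq_ltn_trans jK Kk.
  + by rewrite vZ //; apply/dZ => //; exact: leq_ltn_trans jK Kk.
  + by apply/dZ => //; exact: leq_ltn_trans jK Kk.
  + by rewrite vZ.
- apply: extends_sub_hgraph; split=> [[s j] ds|]; last exact: vZ.
  have [st jk] := tkmax _ _ ds; have [_ /andP[h1 h2]] := (E s j).1 ds.
  rewrite /= /ts' jk h1; case: ifP => // _.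
  by rewrite (le_trans st) // lerDl ltW.
- move=> dE; have : hdom (X w0) (t + m * T, k).
    by rewrite dE /= /ts' leqnn ltnn lexx (le_trans tskt) // lerDl ltW.
  by move=> /tkmax[+ _]; rewrite gerDl leNgt mT.
Qed.

Lemma max_rand_sol_complete X xi : Cset xi -> max_rand_sol om e r T X xi ->
  forall w, complete (X w).
Proof.
move=> Cxi [RX maxX] w; apply: contrapT => nc; apply: maxX.
exact: rand_sol_extend nc.
Qed.

End Maximality.

(** * Strategies that lead to synchronization *)

Section Levels.
Set Implicit Arguments. Unset Strict Implicit.
Context {N : nat} (e : rel 'I_N).

Definition level (i : 'I_N) (q : nat) : {set 'I_N} :=
  iter q (fun S : {set 'I_N} => [set j | (j \in S) || [exists k in S, e k j]]%SET) [set i]%SET.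

Lemma level_sub i q : level i q \subset level i q.+1.
Proof. by apply/fintype.subsetP => j jq; rewrite inE jq. Qed.

Lemma level_mono i a b : (a <= b)%N -> level i a \subset level i b.
Proof.
elim: b => [|b IH]; first by rewrite leqn0 => /eqP->.
rewrite leq_eqVlt => /orP[/eqP->//|/IH ab].
exact: fintype.subset_trans ab (level_sub _ _).
Qed.

Lemma level_refl i q : i \in level i q.
Proof. by apply: (fintype.subsetP (level_mono i (leq0n q))); rewrite inE. Qed.

Lemma level_path i s : path e i s -> last i s \in level i (size s).
Proof.
elim/last_ind: s => [|s j IH]; first by rewrite inE.
rewrite rcons_path size_rcons last_rcons => /andP[/IH ls lj].
by rewrite inE; apply/orP; right; apply/existsP; exists (last i s); rewrite ls.
Qed.

Lemma level_dep i : is_root e i -> level i (dep e) = [set: 'I_N]%SET.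
Proof.
move=> ri; apply/setP => j; rewrite inE.
have [->|ji] := eqVneq j i; first exact: level_refl.
have [s gs] := ri j ji.
have hlen : exists n, has_path_len e i j n by exists (size s); apply/asboolP; exists s.
have [s' [/and3P[ps' _ /eqP <-] ls']] : exists s', gpath e i j s' /\ size s' = depth e i j.
  rewrite /depth; case: pselect => // h; by case: ex_minnP => m /asboolP.
apply: (fintype.subsetP (level_mono i _) _ (level_path ps')).
rewrite ls'; apply: (@leq_trans (qstar e i)); first exact: (@bigop.leq_bigmax _ (depth e i) _).
by apply: (@bigop.leq_bigmax_cond _ _ (qstar e) i); apply/asboolP.
Qed.

(** Contrapositive use: a vertex that is not a root has no edge into a root, so its jumps leave the
    clocks of the roots alone. *)
Lemma root_pred i j : is_root e i -> e j i -> is_root e j.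
Proof.
move=> ri ji k kj.
have [s [ps ls]] : exists s, path e j s /\ last j s = k.
  have [->|/ri[s /and3P[ps _ /eqP ls]]] := eqVneq k i.
    by exists [:: i]; rewrite /= ji.
  by exists (i :: s); rewrite /= ji.
move: ls; case: (shortenP ps) => s' ps' us' _ <-.
by exists s'; rewrite /gpath ps' us' /=.
Qed.

End Levels.

(** * A game against the choices of the solution *)

Section Game.
Set Implicit Arguments. Unset Strict Implicit.
Context {R : realType} {N : nat} {e : rel 'I_N} {r : 'I_N -> R} {T : R} (p : R).
Context (r01 : forall j, 0 < r j < 1) (T0 : 0 < T) (p01 : 0 < p < 1).
Implicit Types (z g : @state R N) (L S : {set 'I_N}) (n m : nat) (x t c tb : R).

(** Lower bound for the probability that exactly the vertices of [L] fire. All [N] vertices are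
    counted, also those without out-neighbours, which draw no bit, so that the value depends on [L]
    through its cardinality only. *)
Definition force_prob L := p ^+ #|L| * (1 - p) ^+ (N - #|L|).

(* [W n x z t] is to be read: from state [z] at time [t], synchronization before the deadline has
   conditional probability at least [x], if at most [n] more jumps can occur. *)
Context (tend : R) (W : nat -> R -> @state R N -> R -> Prop).
Context (W0 : forall x z t, W 0 x z t).
Context (Wmono : forall n x y z t, y <= x -> W n x z t -> W n y z t).
Context (Wasync : forall n z t, Cset z -> Async z -> W n 1 z t).
Context (Wflow : forall n x z t, 0 <= x <= 1 -> Cset z ->
  (forall h, 0 <= h -> Cset (fun i => z i + h) -> (exists i, z i + h = 1) ->
     t + h * T <= tend /\ W n x (fun i => z i + h) (t + h * T)) -> W n x z t).
Context (Wjump : forall n x z t, 0 <= x <= 1 -> Cset z -> (exists i, z i = 1) ->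
  (forall i b g, jump e r i b z g -> W n x g t) -> W n.+1 x z t).
Context (Wforce : forall L n x z t, 0 <= x <= 1 -> Cset z -> (exists i, z i = 1) ->
  (forall i g, jump e r i (i \in L) z g -> W n x g t) -> W n.+1 (force_prob L * x) z t).

Definition on01 S z := forall j, j \in S -> z j = 0 \/ z j = 1.

Let p0 : 0 < p. Proof. by case/andP: p01. Qed.
Let p1 : p < 1. Proof. by case/andP: p01. Qed.
Let q0 : 0 < 1 - p. Proof. by rewrite subr_gt0. Qed.
Let q1 : 1 - p <= 1. Proof. by have := p0; lra. Qed.

Lemma force_prob_gt0 L : 0 < force_prob L.
Proof. by rewrite mulr_gt0 // exprn_gt0. Qed.

Lemma force_prob_le1 L : force_prob L <= 1.
Proof. by rewrite mulr_ile1 ?exprn_ile1 ?exprn_ge0 // ltW. Qed.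

Lemma force_probX_mulr_le L m x : 0 <= x <= 1 -> force_prob L ^+ m * x <= x.
Proof.
move=> /andP[x0 _]; rewrite ler_piMl // exprn_ile1 ?force_prob_le1 //.
exact: ltW (force_prob_gt0 _).
Qed.

Lemma force_probX_01 L m x : 0 <= x <= 1 -> 0 <= force_prob L ^+ m * x <= 1.
Proof.
move=> x01; have /andP[x0 x1] := x01; rewrite (le_trans (force_probX_mulr_le _ _ x01)) // andbT.
by rewrite mulr_ge0 // exprn_ge0 // ltW // force_prob_gt0.
Qed.

(** Invariant: each vertex of [L] is still at 1 or has all its out-neighbours at 0 or 1. While the
    second alternative fails somewhere, a clock at 1 allows a jump at the same instant; each jump
    lowers the count of clocks above threshold, so [m] prescribed draws suffice. *)
Lemma game_fire S L S' n m z t x : 0 <= x <= 1 ->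
  (forall j, j \in S' -> j \in S \/ exists2 i, i \in L & e i j) ->
  Cset z -> on01 S z ->
  (forall i, i \in L -> z i = 1 \/ forall j, e i j -> z j = 0 \/ z j = 1) ->
  (#|above (r := r) 0 z| <= m)%N ->
  (forall n g, Cset g -> on01 S' g -> W n x g t) ->
  W n (force_prob L ^+ m * x) z t.
Proof.
move=> x0 S'S + + + + cont; elim: n m z => [|n IH] m z Cz Sz Lz cz; first exact: W0.
have [done|] := pselect (forall i, i \in L -> forall j, e i j -> z j = 0 \/ z j = 1).
  apply: Wmono (force_probX_mulr_le _ _ x0) _; apply: cont => // j /S'S[/Sz//|[i iL]].
  exact: done.
move=> /existsNP[i /not_implyP[iL nd]].
have zi : z i = 1 by case: (Lz i iL).
case: m cz => [|m] cz.
  have : i \in above (r := r) 0 z by rewrite inE zi; have := r01 i; lra.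
  by rewrite (card0_eq (_ : #|above 0 z| = 0%N)) //; apply/eqP; rewrite -leqn0.
rewrite exprS -mulrA; apply: Wforce => //; [exact: force_probX_01|by exists i|].
move=> k g J; apply: IH.
- exact: jump_Cset J.
- by move=> j /Sz; exact: jump_keep01 J.
- move=> l lL; have [zl|outs] := Lz l lL; last first.
    by right=> j /outs; exact: jump_keep01 J.
  have [lk|lk] := eqVneq l k; last by left; exact: jump_keep1 J lk zl.
  by right=> j; rewrite lk; rewrite -lk lL lk in J; exact: jump_out01 J.
- have : (#|above (r := r) 0 g| < #|above (r := r) 0 z|)%N.
    by apply: jump_above J => // j; case/andP: (r01 j).
  by move=> h; rewrite -ltnS; exact: leq_trans h cz.
Qed.

(* No vertex fires: each clock ahead of the common value of the cohort is reset at most once. *)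
Lemma game_wait S i0 tb n m z t c x : 0 <= x <= 1 -> i0 \in S -> tb <= tend ->
  (forall n g t', Cset g -> (forall j, j \in S -> g j = 1) -> t' <= tb -> W n x g t') ->
  Cset z -> (forall j, j \in S -> z j = c) -> 0 <= c ->
  (#|[set j | (c < z j)%R]%SET| <= m)%N -> t + (1 - c) * T <= tb ->
  W n (force_prob finset.set0 ^+ m * x) z t.
Proof.
move=> x0 i0S tbe cont; elim: n m z t c => [|n IH] m z t c Cz zc c0 cm tc; first exact: W0.
apply: Wflow; [exact: force_probX_01|by []|move=> h h0 Cz' zmax].
have c1 : c + h <= 1 by have /andP[_] := Cz' i0; rewrite zc.
have hT : h * T <= (1 - c) * T by rewrite ler_wpM2r ?(ltW T0) //; lra.
split; first lra.
have [cE|cn] := eqVneq (c + h) 1.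
  apply: Wmono (force_probX_mulr_le _ _ x0) _; apply: cont => //; last lra.
  by move=> j /zc ->.
have c1' : c + h < 1 by rewrite lt_neqAle cn.
case: m cm => [|m] cm.
  have [i zi] := zmax; have : i \in [set j | (c < z j)%R]%SET by rewrite inE; lra.
  by rewrite (card0_eq (_ : #|[set j | (c < z j)%R]%SET| = 0%N)) //; apply/eqP; rewrite -leqn0.
rewrite exprS -mulrA; apply: Wforce => //; first exact: force_probX_01.
move=> i g J; rewrite inE in J; have [ui _ gi Jj] := J.
have same j : j != i -> g j = z j + h by move=> ji; have := Jj j ji; rewrite andbF.
apply: (IH m g _ (c + h)).
- exact: jump_Cset J.
- move=> j jS; rewrite same ?zc //; apply/eqP => ji; move: ui; rewrite -ji zc //; lra.
- lra.
- rewrite -ltnS; apply: leq_trans cm; apply: proper_card; apply/properP; split.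
    apply/fintype.subsetP => j; rewrite !inE; have [->|ji] := eqVneq j i.
      by rewrite gi => ?; lra.
    by rewrite same // ltrD2r.
  by exists i; rewrite inE; lra.
- by rewrite (_ : (1 - (c + h)) * T = (1 - c) * T - h * T); lra.
Qed.

(** Clocks of [S] at 1 are reset by jumps under arbitrary draws, which cost nothing, and clocks at 0
    or 1 remain so. Only the waiting that follows pays for draws. *)
Lemma game_settle S i0 tb n z t x : 0 <= x <= 1 -> i0 \in S -> tb <= tend ->
  (forall n g t', Cset g -> (forall j, j \in S -> g j = 1) -> t' <= tb -> W n x g t') ->
  Cset z -> on01 S z -> t + T <= tb ->
  W n (force_prob finset.set0 ^+ N * x) z t.
Proof.
move=> x0 i0S tbe cont + + tt; elim: n z => [|n IH] z Cz Sz; first exact: W0.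
have [z0|] := pselect (forall j, j \in S -> z j = 0).
  apply: (game_wait _ x0 i0S tbe cont Cz z0) => //; last by rewrite subr0 mul1r.
  by rewrite -[X in (_ <= X)%N]card_ord max_card.
move=> /existsNP[j /not_implyP[jS zj]].
apply: Wjump => //; [exact: force_probX_01|by exists j; case: (Sz j jS)|].
move=> i b g J; apply: IH; first exact: jump_Cset J.
by move=> k /Sz; exact: jump_keep01 J.
Qed.

Lemma game_phase S L S' i0 n z t x : 0 <= x <= 1 -> i0 \in S -> L \subset S ->
  (forall j, j \in S' -> j \in S \/ exists2 i, i \in L & e i j) ->
  t + T <= tend ->
  (forall n g t', Cset g -> on01 S' g -> t' <= t + T -> W n x g t') ->
  Cset z -> on01 S z ->
  W n (force_prob finset.set0 ^+ N * (force_prob L ^+ N * x)) z t.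
Proof.
move=> x0 i0S /fintype.subsetP LS S'S tt cont Cz Sz.
apply: (game_settle (tb := t + T) _ _ i0S tt _ Cz Sz) => //; first exact: force_probX_01.
move=> n' g t' Cg g1 t't; apply: (game_fire _ x0 S'S) => //.
- by move=> j /g1; right.
- by move=> i /LS/g1; left.
- by rewrite -[X in (_ <= X)%N]card_ord max_card.
- by move=> n'' g' Cg' g'1; exact: cont.
Qed.

(** Cost of [k] remaining stages. The sets that fire are disjoint and outside [level e i q], and
    each vertex is charged [p] at most [N] times. Each stage is charged [1 - p] at most [N * N]
    times for waiting and as often for the vertices that stay silent while the layer fires. *)
Definition level_prob i q k := p ^+ (N * (N - #|level e i q|)) * (1 - p) ^+ (2 * N * N * k).

Lemma level_prob_01 i q k : 0 <= level_prob i q k <= 1.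
Proof. by rewrite mulr_ge0 ?mulr_ile1 ?exprn_ile1 ?exprn_ge0 // ltW. Qed.

Lemma level_probS i q k : level_prob i q k.+1 <=
  force_prob finset.set0 ^+ N *
  (force_prob (level e i q.+1 :\: level e i q) ^+ N * level_prob i q.+1 k).
Proof.
set L := _ :\: _.
have cL : (#|level e i q| + #|L| = #|level e i q.+1|)%N.
  by rewrite cardsDS ?level_sub // subnKC // subset_leq_card // level_sub.
have cN : (#|level e i q.+1| <= N)%N by rewrite -[X in (_ <= X)%N]card_ord max_card.
rewrite /level_prob /force_prob cards0 expr0 mul1r subn0.
rewrite (_ : N - #|level e i q| = #|L| + (N - #|level e i q.+1|))%N; last by lia.
rewrite mulnDr exprD mulnS exprD.
rewrite exprMn -!exprM.
rewrite (_ : 2 * N * N = N * N + N * N)%N; last by lia.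
rewrite exprD (mulnC N #|L|).
set A := p ^+ (#|L| * N); set B := (1 - p) ^+ (N * N); set C := p ^+ (N * (N - _)).
set D := (1 - p) ^+ ((N * N + N * N) * k).
have BE : B <= (1 - p) ^+ ((N - #|L|) * N).
  by apply: ler_wiXn2l; rewrite ?q1 ?(ltW q0) // leq_mul2r leq_subr orbT.
have AC : 0 <= B * A * C * D by rewrite !mulr_ge0 ?exprn_ge0 // ltW.
rewrite (_ : A * C * (B * B * D) = (B * A * C * D) * B); last by lra.
rewrite (_ : B * (A * _ * (C * D)) = (B * A * C * D) * (1 - p) ^+ ((N - #|L|) * N)); last by lra.
exact: ler_wpM2l.
Qed.

Lemma game_levels i k q n z t : is_root e i -> (q.+1 + k = dep e)%N ->
  t + k%:R * T <= tend -> Cset z -> on01 (level e i q.+1) z ->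
  W n (level_prob i q k) z t.
Proof.
move=> ri; elim: k q n z t => [|k IH] q n z t qk tt Cz lz.
  apply: (@Wmono _ 1); last first.
    apply: Wasync => //; right => j; apply: lz.
    by rewrite -(addn0 q.+1) qk level_dep // inE.
  by case/andP: (level_prob_01 i q 0).
apply: Wmono (level_probS _ _ _) _.
have kT : 0 <= k%:R * T by rewrite mulr_ge0 // ltW.
apply: (game_phase (S' := level e i q.+2) _ (level_prob_01 _ _ _) (level_refl e i q.+1) _ _ _ _ Cz lz).
- exact: subsetDl.
- move=> j; rewrite inE => /orP[|/existsP[l /andP[lq lj]]]; first by left.
  (* Out-neighbours of vertices within distance [q] are already in the ball of radius [q.+1], so
     only the outermost layer has to fire. *)
  have [lq'|lq'] := boolP (l \in level e i q); last first.
    by right; exists l => //; rewrite inE lq' lq.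
  by left; rewrite inE; apply/orP; right; apply/existsP; exists l; rewrite lq'.
- by move: tt; rewrite -natr1 mulrDl mul1r; lra.
- move=> n' g t' Cg lg t't; apply: IH => //; first by rewrite -qk addSnnS.
  by move: tt; rewrite -natr1 mulrDl mul1r; lra.
Qed.

Context (D' : nat) (depS : dep e = D'.+1).

(** [level_prob] at level 0, whose ball is a single vertex. Only [D'] stages remain, since the
    firing of the root itself settles the first layer. *)
Definition root_prob := p ^+ (N * (N - 1)) * (1 - p) ^+ (2 * N * N * D').

Lemma root_prob_01 : 0 <= root_prob <= 1.
Proof. by rewrite mulr_ge0 ?mulr_ile1 ?exprn_ile1 ?exprn_ge0 // ltW. Qed.

(** Other clocks may be at 1 together with that of the root [i] and be reset earlier; meanwhile [i]
    stays at 1. The argument continues with whichever root fires first, which is why [dep e] is a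
    maximum over all roots. *)
Lemma game_force_root n m z t : t + D'%:R * T <= tend -> Cset z ->
  (exists2 i, is_root e i & z i = 1) -> (#|above (r := r) 0 z| <= m)%N ->
  W n (force_prob finset.setT ^+ m * root_prob) z t.
Proof.
move=> tt; elim: n m z => [|n IH] m z Cz [i ri zi] cz; first exact: W0.
case: m cz => [|m] cz.
  have : i \in above (r := r) 0 z by rewrite inE zi; have := r01 i; lra.
  by rewrite (card0_eq (_ : #|above 0 z| = 0%N)) //; apply/eqP; rewrite -leqn0.
rewrite exprS -mulrA; apply: Wforce => //; [by apply: force_probX_01; exact: root_prob_01|by exists i|].
move=> k g; rewrite inE => J.
have Cg := jump_Cset J.
have [rk|nrk] := pselect (is_root e k).
  apply: Wmono (force_probX_mulr_le _ _ root_prob_01) _.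
  have -> : root_prob = level_prob k 0 D' by rewrite /level_prob cards1.
  apply: game_levels => //.
  move=> j; rewrite inE => /orP[|/existsP[l /andP[]]]; rewrite inE => /eqP->.
    by left; case: J.
  exact: jump_out01 J.
apply: IH => //.
  exists i => //; apply: jump_keep1 J _ zi => //; apply/eqP => ik; apply: nrk; by rewrite -ik.
have h : (#|above (r := r) 0 g| < #|above (r := r) 0 z|)%N.
  by apply: jump_above J => // j; case/andP: (r01 j).
by rewrite -ltnS; exact: leq_trans h cz.
Qed.

(** Until a root is at 1, only other vertices jump, and they cannot touch the clock of [i]. So no
    draw is prescribed and the wait is at most [(1 - z i) * T]. *)
Lemma game_reach_root n z t i tb : is_root e i -> t + (1 - z i) * T <= tb ->
  tb + D'%:R * T <= tend -> Cset z ->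
  W n (force_prob finset.setT ^+ N * root_prob) z t.
Proof.
move=> ri + tbe; elim: n z t => [|n IH] z t tt Cz; first exact: W0.
have DT : 0 <= D'%:R * T by rewrite mulr_ge0 // ltW.
apply: Wflow; [by apply: force_probX_01; exact: root_prob_01|by []|move=> h h0 Cz' zmax].
have hT : h * T <= (1 - z i) * T.
  by rewrite ler_wpM2r ?(ltW T0) //; have /andP[_] := Cz' i; lra.
split; first lra.
have [rmax|nrmax] := pselect (exists2 i, is_root e i & z i + h = 1).
  apply: game_force_root => //; first lra.
  by rewrite -[X in (_ <= X)%N]card_ord max_card.
apply: Wjump => //; first by apply: force_probX_01; exact: root_prob_01.
move=> k b g J; have [uk _ _ Jj] := J.
have nrk : ~ is_root e k by move=> rk; apply: nrmax; exists k.
have ik : i != k by apply/eqP => ik; apply: nrk; rewrite -ik.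
apply: IH; last exact: jump_Cset J.
have := Jj i ik; case: ifP => [/andP[eki _]|_ ->]; first by case: nrk; exact: root_pred ri eki.
by rewrite (_ : (1 - (z i + h)) * T = (1 - z i) * T - h * T); lra.
Qed.

Lemma game_round n z t : rooted e -> Cset z -> t + D'.+1%:R * T <= tend ->
  W n (force_prob finset.setT ^+ N * root_prob) z t.
Proof.
move=> [i ri] Cz; rewrite -natr1 mulrDl mul1r => tt.
apply: (game_reach_root (tb := t + T) _ ri) => //; last lra.
rewrite lerD2l ler_piMl ?(ltW T0) //; have /andP[] := Cz i; lra.
Qed.

End Game.

(** * Conditioning on cylinders *)

Section Forcing.
Set Implicit Arguments. Unset Strict Implicit.
Context {R : realType} {N : nat} (e : rel 'I_N).

Definition firing_edges (L : {set 'I_N}) : @edges N :=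
  [set ij | e ij.1 ij.2 && (ij.1 \in L)]%SET.

Lemma vof_firing_edges L i : i \in Vstar e -> vof e (firing_edges L) i = (i \in L).
Proof.
rewrite inE => /existsP[j eij]; apply/fintype.subsetP/idP => [sub|iL [a b]].
  by have := sub (i, j); rewrite !inE /= eqxx eij => /(_ isT).
by rewrite !inE /= => /andP[/eqP-> ->].
Qed.

(** For a vertex without out-edges [vof] is true under every draw, but its jump does not consult the
    bit. *)
Lemma jump_firing_edges (r : 'I_N -> R) L i u g :
  jump e r i (vof e (firing_edges L) i) u g -> jump e r i (i \in L) u g.
Proof.
move=> [ui Cu gi J]; split => // j ji; have := J j ji.
have [eij|//] := boolP (e i j).
by rewrite vof_firing_edges // inE; apply/existsP; exists j.
Qed.

Lemma feasible_firing_edges L : feasible e (firing_edges L).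
Proof.
apply/andP; split.
  by apply/fintype.subsetP => -[a b]; rewrite !inE /= => /andP[].
apply/forallP => i; have [iL|niL] := boolP (i \in L); apply/orP; [left|right].
  by apply/fintype.subsetP => -[a b]; rewrite !inE /= => /andP[/eqP-> ->].
rewrite disjoint_subset; apply/fintype.subsetP => -[a b].
by rewrite !inE /= => /andP[/eqP-> ->]; rewrite /= niL.
Qed.

Lemma mu_firing_edges (p : R) L : 0 < p < 1 -> force_prob p L <= mu e p (firing_edges L).
Proof.
move=> /andP[p0 p1]; have q0 : 0 < 1 - p by rewrite subr_gt0.
have q1 : 1 - p <= 1 by lra.
rewrite /mu feasible_firing_edges.
rewrite (_ : [set i in _ | _]%SET = Vstar e :&: L); last first.
  apply/setP => i; rewrite finset.in_set finset.in_setI.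
  by have [iV|//] := boolP (i \in Vstar e); rewrite vof_firing_edges.
have c1 := cardsID L (Vstar e).
have c2 : (#|Vstar e :&: L| <= #|L|)%N by rewrite subset_leq_card // finset.subsetIr.
have c3 : (#|Vstar e :\: L| <= #|~: L|)%N.
  by rewrite subset_leq_card // finset.setDE finset.subsetIr.
have c4 := cardsC L; rewrite card_ord in c4.
apply: ler_pM; rewrite ?exprn_ge0 ?(ltW p0) ?(ltW q0) //.
  by apply: ler_wiXn2l; rewrite ?(ltW p0) ?(ltW p1).
by apply: ler_wiXn2l; rewrite ?(ltW q0) //; lia.
Qed.

End Forcing.

(** * Conditional bounds given the first draws *)

Section Cylinders.
Set Implicit Arguments. Unset Strict Implicit.
Context {R : realType} {N : nat} {e : rel 'I_N} {p : R}.
Context {d : measure_display} {Omega : measurableType d} (P : probability Omega R).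
Context (om : nat -> Omega -> @edges N) (iid : iid_law P om e p).

Lemma iid_meas k phi : measurable [set w | om k w = phi].
Proof. by case: iid => h _; exact: h. Qed.

Definition Pr (B : set Omega) : R := fine (P B).

Lemma PrE B : measurable B -> P B = (Pr B)%:E.
Proof. by move=> mB; rewrite /Pr fineK // fin_num_measure. Qed.

Lemma Pr_ge0 B : 0 <= Pr B.
Proof. exact: fine_ge0. Qed.

Lemma Pr_set0 : Pr set0 = 0.
Proof. by rewrite /Pr measure0. Qed.

Lemma Pr_setT : Pr setT = 1.
Proof. by rewrite /Pr probability_setT. Qed.

Lemma Pr_le A B : measurable A -> measurable B -> A `<=` B -> Pr A <= Pr B.
Proof. by move=> mA mB AB; rewrite -lee_fin -!PrE // le_measure // inE. Qed.

Lemma PrU A B : measurable A -> measurable B -> A `&` B = set0 ->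
  Pr (A `|` B) = Pr A + Pr B.
Proof.
move=> mA mB AB; apply: EFin_inj; rewrite EFinD -!PrE //; last exact: measurableU.
exact: measureU.
Qed.

Lemma Pr_partition (B : set Omega) k : measurable B ->
  Pr B = \sum_(phi : @edges N) Pr (B `&` [set w | om k w = phi]).
Proof.
move=> mB.
have mE (s : seq (@edges N)) : measurable (B `&` [set w | om k w \in s]).
  apply: measurableI => //; apply: (agree_measurable iid_meas (K := k.+1)) => w w' a /=.
  by rewrite a.
suff H (s : seq (@edges N)) : uniq s -> Pr (B `&` [set w | om k w \in s]) =
    \sum_(phi <- s) Pr (B `&` [set w | om k w = phi]).
  rewrite -big_enum -H ?enum_uniq //; congr Pr; apply/seteqP; split=> w; last by case.
  by move=> Bw; split => //=; rewrite mem_enum.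
elim: s => [|phi s IH]; first by rewrite big_nil => _; rewrite (_ : _ `&` _ = set0) ?Pr_set0 //; apply/seteqP; split=> w // [].
move=> /= /andP[ns us]; rewrite big_cons -IH // -PrU //.
- congr Pr; apply/seteqP; split=> w /=.
    by rewrite inE => -[Bw /orP[/eqP ->|ws]]; [left|right].
  by case=> -[Bw]; rewrite inE; [move=> ->; rewrite eqxx|move=> ->; rewrite orbT].
- by apply: measurableI => //; exact: iid_meas.
- by apply/seteqP; split=> w // [[_ /= ->] [_ /= h]]; rewrite h in ns.
Qed.

Definition cyl k w := [set w' | agree om k w w'].

Lemma cyl_measurable k w : measurable (cyl k w).
Proof. by apply: (agree_measurable iid_meas (K := k)) => u v a b; exact: agree_trans b a. Qed.

Lemma Pr_cyl k w phi :
  Pr (cyl k w `&` [set w' | om k w' = phi]) = Pr (cyl k w) * mu e p phi.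
Proof.
have [_ prodP] := iid.
have E n (psi : 'I_n -> @edges N) B :
    B = \bigcap_(i in [set i : 'I_n | True]) [set w | om i w = psi i] ->
    Pr B = \prod_(i < n) mu e p (psi i).
  by move=> ->; rewrite /Pr prodP.
rewrite [Pr (cyl k w)](E k (fun i => om i w)).
  rewrite [LHS](E k.+1 (fun i : 'I_k.+1 => if (i < k)%N then om i w else phi)).
    by rewrite big_ord_recr /= ltnn; congr (_ * _); apply: eq_bigr => i _; rewrite ltn_ord.
  apply/seteqP; split=> w'.
    move=> [a /= <-] i _ /=; case: ltnP => [/a //|ki].
    by congr (om _ _); apply/eqP; rewrite eqn_leq ki -ltnS ltn_ord.
  move=> a; split; last by have /= := a ord_max I; rewrite ltnn.
  by move=> i ik; have /= := a (Ordinal (leqW ik)) I; rewrite ik.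
apply/seteqP; split=> w'; first by move=> a i _; rewrite /= a.
by move=> a i ik; have /= -> := a (Ordinal ik) I.
Qed.

Lemma cylS k w w' phi : cyl k w w' -> om k w' = phi ->
  cyl k w `&` [set v | om k v = phi] = cyl k.+1 w'.
Proof.
move=> ww' wphi; apply/seteqP; split=> v.
  move=> [wv vphi] i; rewrite ltnS leq_eqVlt => /orP[/eqP ->|ik]; first by rewrite wphi.
  by rewrite -ww' // wv.
move=> w'v; split; last by rewrite /= -w'v.
by move=> i ik; rewrite ww' // w'v // leqW.
Qed.

Context (A : set Omega) (mA : measurable A).

(** Conditional probability at most [q] given the first [k] draws, multiplied out so that it makes
    sense on null cylinders. *)
Definition cond_le k w q := Pr (A `&` cyl k w) <= q * Pr (cyl k w).

Lemma cond_le_mono k w q q' : q <= q' -> cond_le k w q -> cond_le k w q'.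
Proof. by move=> qq h; apply: le_trans h _; rewrite ler_wpM2r // Pr_ge0. Qed.

Lemma cond_le1 k w : cond_le k w 1.
Proof.
rewrite /cond_le mul1r; apply: Pr_le; last by move=> ? [].
  by apply: measurableI => //; exact: cyl_measurable.
exact: cyl_measurable.
Qed.

Lemma cond_le_disj k w q : 0 <= q -> (forall w', cyl k w w' -> ~ A w') -> cond_le k w q.
Proof.
move=> q0 h; rewrite /cond_le (_ : _ `&` _ = set0) ?Pr_set0 ?mulr_ge0 ?Pr_ge0 //.
by apply/seteqP; split=> w' // [Aw' /h].
Qed.

Lemma cond_le_step k w (q : @edges N -> R) :
  (forall w', cyl k w w' -> cond_le k.+1 w' (q (om k w'))) ->
  cond_le k w (\sum_phi mu e p phi * q phi).
Proof.
move=> h; rewrite /cond_le (Pr_partition k); last first.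
  by apply: measurableI => //; exact: cyl_measurable.
rewrite mulr_suml; apply: ler_sum => phi _.
rewrite -mulrA (mulrC (q phi)) mulrA (mulrC (mu e p phi)) -Pr_cyl -setIA.
(* [Omega] is an abstract space and may contain no sample point with this continuation; its term
   then vanishes. *)
have [[w' [c wphi]]|no] := pselect (exists w', cyl k w w' /\ om k w' = phi).
  by rewrite (cylS c wphi) -wphi mulrC; exact: h.
rewrite (_ : cyl k w `&` _ = set0) ?setI0 ?Pr_set0 ?mul0r //.
by apply/seteqP; split=> w' // [c wphi]; apply: no; exists w'.
Qed.

Lemma mu_ge0 phi : 0 <= mu e p phi.
Proof.
have [w _] : [set: Omega] !=set0.
  apply: contrapT => /set0P/negP; rewrite negbK => /eqP T0.
  by have := Pr_setT; rewrite T0 Pr_set0 => /eqP; rewrite eq_sym oner_eq0.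
have := Pr_cyl 0 w phi; rewrite (_ : cyl 0 w = setT) ?Pr_setT ?mul1r; last first.
  by apply/seteqP; split.
by move=> <-; exact: Pr_ge0.
Qed.

(** Obtained from the law of the first draw, which avoids summing the formula for [mu] over feasible
    subgraphs. *)
Lemma sum_mu : \sum_phi mu e p phi = 1.
Proof.
have [w _] : [set: Omega] !=set0.
  apply: contrapT => /set0P/negP; rewrite negbK => /eqP T0.
  by have := Pr_setT; rewrite T0 Pr_set0 => /eqP; rewrite eq_sym oner_eq0.
have cT : cyl 0 w = setT by apply/seteqP; split.
rewrite -Pr_setT (Pr_partition 0 measurableT); apply: eq_bigr => phi _.
by rewrite -cT Pr_cyl cT Pr_setT mul1r.
Qed.

Lemma cond_le_next k w q : (forall w', cyl k w w' -> cond_le k.+1 w' q) -> cond_le k w q.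
Proof.
move=> h; have := cond_le_step (q := fun=> q) h.
by rewrite -mulr_suml sum_mu mul1r.
Qed.

Lemma cond_le_force k w phi q1 q2 :
  (forall w', cyl k w w' -> om k w' = phi -> cond_le k.+1 w' q1) ->
  (forall w', cyl k w w' -> cond_le k.+1 w' q2) ->
  cond_le k w (mu e p phi * q1 + (1 - mu e p phi) * q2).
Proof.
move=> h1 h2.
rewrite (_ : _ + _ = \sum_f mu e p f * (if f == phi then q1 else q2)).
  by apply: cond_le_step => w' c; case: eqVneq => [/h1|_]; [exact|exact: h2].
have S := sum_mu; rewrite (bigD1 phi) //= in S.
have -> : 1 - mu e p phi = \sum_(f | f != phi) mu e p f by apply: (addrI (mu e p phi)); rewrite S subrKC.
rewrite [in RHS](bigD1 phi) //= eqxx mulr_suml; congr (_ + _).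
by apply: eq_bigr => f /negbTE ->.
Qed.

End Cylinders.

(** * Probability of late synchronization *)

Section RoundProbability.
Set Implicit Arguments. Unset Strict Implicit.
Context {R : realType} {N : nat} (p : R) (D' : nat).

Definition round_prob : R := force_prob p [set: 'I_N]%SET ^+ N * @root_prob R N p D'.

(** The exponent of [p] is [N * N + N * (N - 1)]: all vertices fire until a root does, then every
    vertex other than that root is charged at most [N] times. *)
Lemma round_prob_ge lstar : 0 < p < 1 -> (2 * N <= lstar)%N ->
  (p * (1 - p) ^+ D') ^+ (N * lstar) <= round_prob.
Proof.
move=> p01 lN; have /andP[p0 p1] := p01; have q0 : 0 < 1 - p by rewrite subr_gt0.
have q1 : 1 - p <= 1 by have := p0; lra.
rewrite /round_prob /force_prob /root_prob cardsT card_ord subnn expr0 mulr1.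
rewrite -exprM mulrA -exprD exprMn -exprM.
have NN : (N * (2 * N) <= N * lstar)%N by rewrite leq_mul2l lN orbT.
apply: ler_pM; rewrite ?exprn_ge0 ?(ltW p0) ?(ltW q0) //.
  by apply: ler_wiXn2l; rewrite ?(ltW p0) ?(ltW p1) //; nia.
by apply: ler_wiXn2l; rewrite ?(ltW q0) //; nia.
Qed.

Lemma rate_bounds lstar : (0 < N)%N -> 0 < p < 1 -> (0 < lstar)%N ->
  0 < 1 - (p * (1 - p) ^+ D') ^+ (N * lstar) < 1.
Proof.
move=> N0 p01 l0; have /andP[p0 p1] := p01; have q0 : 0 < 1 - p by rewrite subr_gt0.
have x0 : 0 < p * (1 - p) ^+ D' by rewrite mulr_gt0 // exprn_gt0.
have x1 : p * (1 - p) ^+ D' < 1.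
  apply: le_lt_trans p1; rewrite ler_piMr ?(ltW p0) // exprn_ile1 ?(ltW q0) //; lra.
rewrite subr_gt0 gtrBl exprn_gt0 // andbT.
by rewrite exprn_ilt1 ?(ltW x0) // -lt0n muln_gt0 N0.
Qed.

End RoundProbability.

Section LateProbability.
Set Implicit Arguments. Unset Strict Implicit.
Context {R : realType} {N : nat} {e : rel 'I_N} {r : 'I_N -> R} {T p : R}.
Context (N0 : (0 < N)%N) (r01 : forall j, 0 < r j < 1) (T0 : 0 < T) (p01 : 0 < p < 1).

Lemma hsol_next_jump x xi om t k s k' : @is_hsol R N e r T x xi om -> Cset xi ->
  hdom x (t, k) -> hdom x (s, k') -> t + T < s ->
  exists t1, [/\ t <= t1, hdom x (t1, k), hdom x (t1, k.+1) & exists i, hval x t1 k i = 1].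
Proof.
move=> H Cxi dt ds ts; have ts' : t < s by have := T0; lra.
have := hsol_dom_lt T0 H dt ds ts'; rewrite leq_eqVlt => /orP[/eqP kE|kk'].
  subst k'; have i := Ordinal N0.
  have /andP[z0 _] := hsol_Cset T0 H Cxi dt i.
  have /andP[_] := hsol_Cset T0 H Cxi ds i.
  rewrite (hsol_affine H i dt ds (ltW ts')) => h.
  have : 1 < (s - t) / T by rewrite ltr_pdivlMr //; lra.
  by lra.
have [t1 [_ d1 d2]] := hsol_dom_jump H ds kk'.
exists t1; split => //; first exact: (hsol_jump_last T0 H d1 d2 dt).
by have [i [ui _ _ _]] := hsol_jump H d1 d2; exists i.
Qed.

Context {d : measure_display} {Omega : measurableType d} (P : probability Omega R).
Context (om : nat -> Omega -> @edges N) (iid : iid_law P om e p).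
Context (X : Omega -> @harc R N) (xi : @state R N).
Context (RX : rand_sol om e r T X xi) (Cxi : Cset xi).

Let om_meas := iid_meas iid.
Let cX : causal om X := rand_sol_causal RX.
Let hX w : is_hsol e r T (X w) xi (fun k => om k w). Proof. by case: RX. Qed.

(** A fixed time is used instead of the sync-time because the event then depends on finitely many
    draws. If a solution reaches time [s] but synchronizes only later, it is late. *)
Definition late (s : R) : set Omega :=
  [set w | exists k, hdom (X w) (s, k) /\ ~ Async (hval (X w) s k)].

Lemma late_measurable s : measurable (late s).
Proof.
have [K KP] := hsol_jump_count (e := e) r01 T0 s.
apply: (agree_measurable om_meas (K := K)) => w w' a [k [ds nA]].
have [ds' vE] := causal_dom cX a (KP _ _ _ _ _ (hX w) ds (lexx _)) ds.
by exists k; rewrite vE.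
Qed.

Context (D' : nat) (depS : dep e = D'.+1).

Section Round.
Context (s tend q2 : R) (q20 : 0 <= q2) (ts : tend + T < s).
Context (fail : forall w t k, hdom (X w) (t, k) -> t <= tend ->
  cond_le P om (late s) k w q2).
Context (K : nat) (KP : forall w t k, hdom (X w) (t, k) -> t <= s -> (k <= K)%N).

(** With probability [x] the round succeeds and excludes lateness; otherwise [q2], the bound for the
    remaining rounds, is charged. As [K] bounds the jumps up to [s], the condition [K < k + n] keeps
    the budget [n] from running out. *)
Let W (n : nat) (x : R) (z : @state R N) (t : R) : Prop := t <= tend ->
  forall w k, hdom (X w) (t, k) -> hval (X w) t k = z -> (K < k + n)%N ->
  cond_le P om (late s) k w (q2 * (1 - x)).

Let W_mono n x y z t : y <= x -> W n x z t -> W n y z t.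
Proof.
move=> yx h te w k dt vz Kk; apply: cond_le_mono (h te w k dt vz Kk).
by rewrite ler_wpM2l //; lra.
Qed.

Let W_zero x z t : W 0 x z t.
Proof.
move=> te w k dt _; rewrite addn0 ltnNge (KP dt) //.
by apply: le_trans te _; have := T0; have := ts; lra.
Qed.

Let W_async n z t : Cset z -> Async z -> W n 1 z t.
Proof.
move=> _ Az te w k dt vz _; rewrite subrr mulr0.
have tls : t < s by have := T0; have := ts; lra.
apply: cond_le_disj => // w' a [k' [ds]]; apply.
have [dt' vE] := causal_dom cX a (leqnn _) dt.
apply: (hsol_Async_stays r01 T0 N0 (hX w') Cxi dt' _ ds (ltW tls)).
  by rewrite vE vz.
exact: (hsol_dom_lt T0 (hX w') dt' ds tls).
Qed.

Let ge0_cost x : 0 <= x <= 1 -> 0 <= q2 * (1 - x).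
Proof. by move=> /andP[_ x1]; rewrite mulr_ge0 // subr_ge0. Qed.

Let W_flow n x z t : 0 <= x <= 1 -> Cset z ->
  (forall h, 0 <= h -> Cset (fun i => z i + h) -> (exists i, z i + h = 1) ->
     t + h * T <= tend /\ W n x (fun i => z i + h) (t + h * T)) -> W n x z t.
Proof.
move=> x01 Cz h te w k dt vz Kk.
have [[t1 [tt1 d1 [i ui]]]|no] :=
  pselect (exists t1, [/\ t <= t1, hdom (X w) (t1, k) & exists i, hval (X w) t1 k i = 1]).
  have vE : hval (X w) t1 k = fun i => z i + (t1 - t) / T.
    by apply/funext => j; rewrite (hsol_affine (hX w) j dt d1 tt1) vz.
  have tE : t + (t1 - t) / T * T = t1 by rewrite divfK ?gt_eqF //; lra.
  have [|||te' Wn] := h ((t1 - t) / T).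
  - by rewrite divr_ge0 ?subr_ge0 // ltW.
  - by rewrite -vE; exact: (hsol_Cset T0 (hX w) Cxi d1).
  - by exists i; rewrite -ui vE.
  - by apply: (Wn te' w k) => //; rewrite tE.
(* If no clock reaches 1 at jump index [k], the solutions on this cylinder end before [s], hence are
   not late: reaching [s > t + T] would require a jump. *)
apply: cond_le_disj => [|w' a [k' [ds _]]]; first exact: ge0_cost.
have [dt' _] := causal_dom cX a (leqnn _) dt.
have [|t1 [tt1 d1 _ [i ui]]] := hsol_next_jump (hX w') Cxi dt' ds; first by have := ts; lra.
have [d1' vE] := causal_dom cX (agree_sym a) (leqnn _) d1.
by apply: no; exists t1; split => //; exists i; rewrite vE.
Qed.

(** With a clock at 1, flow is impossible: a solution either jumps at [t] or stops there, and in the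
    latter case it never reaches time [s]. *)
Let jump_or_no_late w t k w' : hdom (X w) (t, k) -> t <= tend ->
  (exists i, hval (X w) t k i = 1) -> cyl om k w w' ->
  (hdom (X w') (t, k.+1) /\
   exists i, jump e r i (vof e (om k w') i) (hval (X w) t k) (hval (X w') t k.+1)) \/
  (forall v, cyl om k.+1 w' v -> ~ late s v).
Proof.
move=> dt te [i zi] a.
have [dt' vE'] := causal_dom cX a (leqnn _) dt.
have [dn|ndn] := pselect (hdom (X w') (t, k.+1)).
  by left; split => //; rewrite -vE'; exact: (hsol_jump (hX w') dt' dn).
right => v b [k' [ds _]].
have b' := agree_le (leqnSn k) b.
have [dtv vE] := causal_dom cX b' (leqnn _) dt'.
have [|t1 [tt1 d1 d2 _]] := hsol_next_jump (hX v) Cxi dtv ds; first by have := ts; lra.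
suff t1E : t1 = t.
  by subst t1; apply: ndn; case: (causal_dom cX (agree_sym b) (leqnn _) d2).
apply: le_anti; rewrite tt1 andbT leNgt; apply/negP => t1t.
have /andP[_] := hsol_Cset T0 (hX v) Cxi d1 i.
rewrite (hsol_affine (hX v) i dtv d1 tt1) vE vE' zi.
have : 0 < (t1 - t) / T by rewrite divr_gt0 // subr_gt0.
by lra.
Qed.

Let W_jump n x z t : 0 <= x <= 1 -> Cset z -> (exists i, z i = 1) ->
  (forall i b g, jump e r i b z g -> W n x g t) -> W n.+1 x z t.
Proof.
move=> x01 Cz zmax h te w k dt vz Kk; apply: (cond_le_next iid) => [|w' a].
  exact: late_measurable.
rewrite -vz in zmax.
have [[dn [i J]]|nolate] := jump_or_no_late dt te zmax a; last first.
  by apply: cond_le_disj => //; exact: ge0_cost.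
by rewrite vz in J; apply: (h _ _ _ J te w' k.+1 dn) => //; rewrite addSnnS.
Qed.

Let W_force (L : {set 'I_N}) n x z t : 0 <= x <= 1 -> Cset z -> (exists i, z i = 1) ->
  (forall i g, jump e r i (i \in L) z g -> W n x g t) -> W n.+1 (force_prob p L * x) z t.
Proof.
move=> x01 Cz zmax h te w k dt vz Kk.
rewrite -vz in zmax; set phi := firing_edges e L.
have m0 := mu_ge0 iid phi; have mL : force_prob p L <= mu e p phi := mu_firing_edges e L p01.
(* The prescribed draw leaves [q2 * (1 - x)], any other draw is charged [q2] by [fail]; together
   this is [q2 * (1 - mu e p phi * x)]. *)
apply: (cond_le_mono (q := mu e p phi * (q2 * (1 - x)) + (1 - mu e p phi) * q2)).
  have /andP[x0 _] := x01.
  have : force_prob p L * x <= mu e p phi * x by exact: ler_wpM2r.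
  move=> /(ler_wpM2l q20); lra.
apply: (cond_le_force iid (late_measurable s)) => w' a; last first.
  have [[dn _]|nolate] := jump_or_no_late dt te zmax a; first exact: fail dn te.
  exact: cond_le_disj.
move=> omE; have [[dn [i J]]|nolate] := jump_or_no_late dt te zmax a; last first.
  by apply: cond_le_disj => //; exact: ge0_cost.
rewrite vz omE in J; apply: (h _ _ (jump_firing_edges J) te w' k.+1 dn) => //.
by rewrite addSnnS.
Qed.

Lemma sync_round w t k : rooted e -> hdom (X w) (t, k) -> t + D'.+1%:R * T <= tend ->
  cond_le P om (late s) k w (q2 * (1 - @round_prob R N p D')).
Proof.
move=> re dt tt; have te : t <= tend.
  by apply: le_trans tt; rewrite lerDl mulr_ge0 // ltW.
have Cz := hsol_Cset T0 (hX w) Cxi dt.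
have := game_round r01 T0 p01 W_zero W_mono W_async W_flow W_jump W_force depS K.+1 re Cz tt.
by move=> /(_ te w k dt erefl); apply; rewrite addnS ltnS leq_addl.
Qed.

End Round.

Lemma late_prob n Ts rho : rooted e -> D'.+1%:R * T + T < Ts -> 0 <= rho ->
  1 - @round_prob R N p D' <= rho -> Pr P (late (n%:R * Ts)) <= rho ^+ n.
Proof.
move=> re DT rho0 rho1; set s := n%:R * Ts.
have [K KP] := hsol_jump_count (e := e) r01 T0 s.
have Ts0 : 0 <= Ts.
  by apply: le_trans (ltW DT); rewrite addr_ge0 ?mulr_ge0 // ltW.
suff H m w t k : hdom (X w) (t, k) -> t + m%:R * Ts <= s ->
    cond_le P om (late s) k w (rho ^+ m).
  have [w _] : [set: Omega] !=set0.
    apply: contrapT => /set0P/negP; rewrite negbK => /eqP E.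
    by have := Pr_setT P; rewrite E Pr_set0 => /eqP; rewrite eq_sym oner_eq0.
  have := H n w 0 0%N (hsol_dom00 (hX w)); rewrite add0r => /(_ (lexx _)).
  have cT : cyl om 0 w = setT by apply/seteqP; split.
  by rewrite /cond_le cT setIT Pr_setT mulr1.
elim: m w t k => [|m IH] w t k dt tm.
  by rewrite expr0; apply: (cond_le1 iid); exact: late_measurable.
rewrite -natr1 mulrDl mul1r in tm.
have mTs : 0 <= m%:R * Ts by rewrite mulr_ge0.
(* The present round ends at [tend], and from any state reached by then the induction hypothesis
   bounds the failure of the remaining [m] rounds by [rho ^+ m]. *)
apply: cond_le_mono (sync_round (tend := t + D'.+1%:R * T) (q2 := rho ^+ m) _ _ _ _ re dt (lexx _)).
- by rewrite exprSr; apply: ler_wpM2l => //; rewrite exprn_ge0.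
- exact: exprn_ge0.
- by have := T0; lra.
- by move=> w' t' k' dt' tt'; apply: IH dt' _; have := T0; lra.
- by move=> w' t' k' dt' tt'; exact: (KP _ _ _ _ _ (hX w') dt').
Qed.

End LateProbability.

(** * Sync-triplet and sync-time *)

Section Synchronization.
Set Implicit Arguments. Unset Strict Implicit.
Context {R : realType} {N : nat} {e : rel 'I_N} {r : 'I_N -> R} {T p : R}.
Context (N0 : (0 < N)%N) (r01 : forall j, 0 < r j < 1) (T0 : 0 < T) (p01 : 0 < p < 1).
Context (re : rooted e).
Context {d : measure_display} {Omega : measurableType d} (P : probability Omega R).
Context (om : nat -> Omega -> @edges N) (iid : iid_law P om e p).

(** At depth 0 the root is the only vertex, and a single clock is always synchronized. *)
Lemma dep0_Async (z : @state R N) : dep e = 0%N -> Cset z -> Async z.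
Proof.
move=> d0 Cz; have [i ri] := re; left; exists (z i); split; first exact: Cz.
apply/funext => j; congr z; apply/eqP.
by have := level_dep ri; rewrite d0 => /setP/(_ j); rewrite !inE.
Qed.

Context (lstar : nat) (lN : (2 * N <= lstar)%N).
Let Ts := ((dep e * lstar)%:R + 1) * T.
Let rho := 1 - (p * (1 - p) ^+ (dep e).-1) ^+ (N * lstar).

Let rho01 : 0 < rho < 1.
Proof. by apply: rate_bounds => //; apply: leq_trans lN; rewrite muln_gt0. Qed.

Lemma late_rate X xi n : rand_sol om e r T X xi -> Cset xi ->
  Pr P (late X (n%:R * Ts)) <= rho ^+ n.
Proof.
move=> RX Cxi; have /andP[rho0 _] := rho01.
case dE : (dep e) => [|D'].
  rewrite (_ : late X _ = set0) ?Pr_set0 ?exprn_ge0 ?(ltW rho0) //.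
  apply/seteqP; split=> w // [k [ds]]; apply.
  apply: dep0_Async => //; case: RX => _ _ _ /(_ w) H; exact: (hsol_Cset T0 H Cxi ds).
apply: (late_prob N0 r01 T0 p01 iid RX Cxi dE) => //.
(* Strict because [lstar] is at least 2: a round and a further [T] fit into [Ts]. *)
- have : D'.+1%:R + 1 < (D'.+1 * lstar)%:R + 1 :> R by rewrite ltrD2r ltr_nat ltn_Pmulr //; lia.
  by move=> h; rewrite /Ts dE -(ltr_pM2r T0) in h *; lra.
- exact: ltW.
- by rewrite /rho dE lerD2l lerN2; exact: round_prob_ge.
Qed.

Lemma hsol_after_nbhd_op x xi om' s eps t k : @is_hsol R N e r T x xi om' -> Cset xi ->
  0 < eps -> 0 <= s -> (forall k', hdom x (s, k') -> Async (hval x s k')) ->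
  hdom x (t, k) -> s < t -> nbhd_op eps (hval x t k).
Proof.
move=> H Cxi e0 s0 As dt st.
have [|k' ds] := hsol_dom_at H dt (s := s); first by rewrite s0 ltW.
apply: (in_arc_nbhd_op N0 (s := 0)) => //; first by rewrite mulr0.
  exact: (hsol_Cset T0 H Cxi dt).
apply: Async_in_arc.
exact: (hsol_Async_stays r01 T0 N0 H Cxi ds (As _ ds) dt (ltW st) (hsol_dom_lt T0 H ds dt st)).
Qed.

Lemma prob_ge_setT (E : set Omega) c : 0 <= c -> (forall w, E w) -> prob_ge P E (1 - c).
Proof.
move=> c0 Ew; exists setT; split => //.
by rewrite probability_setT lee_fin gerBl.
Qed.

Lemma nbhd_cl_op (dl eps : R) (z : @state R N) : dl < eps -> nbhd_cl dl z -> nbhd_op eps z.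
Proof. by move=> de [a [Aa h]]; exists a; split => //; exact: le_lt_trans h de. Qed.

Lemma UGASp_rooted : UGASp P om e r T.
Proof.
split=> [eps rho' e0 q0|dl rho' d0 q0|eps rho' Rad e0 q0 _].
- have [|m [/andP[m0 m1] mr]] := @ord_min_gt0 _ N (fun j => Num.min (r j) (1 - r j)).
    by move=> j; rewrite lt_min subr_gt0; exact: r01.
  have NR : 0 < N%:R :> R by rewrite ltr0n.
  (* The arc has to be shorter than all [r j] and [1 - r j]; the factor [N] is the price of the
     Euclidean norm in [enorm_le]. *)
  pose s := Num.min (m / 2) (eps / 2 / N%:R).
  have s0 : 0 < s by rewrite lt_min !divr_gt0.
  have sr j : s < r j /\ s < 1 - r j.
    have sm : s < m by rewrite /s gt_min; apply/orP; left; lra.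
    have := mr j; rewrite le_min => /andP[? ?]; split; lra.
  have Ns : N%:R * s < eps.
    have : s * N%:R <= eps / 2 by rewrite -ler_pdivlMr // /s ge_min lexx orbT.
    by rewrite mulrC; lra.
  have se : s <= N%:R * s by rewrite ler_peMl ?(ltW s0) // ler1n.
  exists (s / 2); split=> [|xi X nxi [RX _]]; first lra.
  apply: prob_ge_setT => [|w t k dt]; first exact: ltW.
  have H : is_hsol e r T (X w) xi (fun k => om k w) by case: RX.
  have [Cxi|nC] := pselect (Cset xi); last first.
    have [tE kE] := hsol_trivial T0 H nC dt; subst t k.
    have -> : hval (X w) 0 0 = xi by case: H.
    by apply: nbhd_cl_op nxi; lra.
  apply: (in_arc_nbhd_op N0 (ltW s0) Ns); first exact: (hsol_Cset T0 H Cxi dt).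
  apply: (hsol_in_arc T0 H Cxi (ltW s0) sr (hsol_dom00 H) _ dt) => //.
    have -> : hval (X w) 0 0 = xi by case: H.
    by have := nbhd_cl_in_arc N0 nxi; rewrite (_ : 2 * (s / 2) = s); last lra.
  exact: (hsol_dom_ge0 H dt).
(* The whole cube is an arc of length 1, hence within [N] of the synchronization set; [dl] covers
   initial states outside the cube. *)
- exists (dl + N%:R + 1); split=> [|xi X nxi [RX _]].
    by have : 0 <= N%:R :> R by []; lra.
  apply: prob_ge_setT => [|w t k dt]; first exact: ltW.
  have NR : 0 <= N%:R :> R by [].
  have H : is_hsol e r T (X w) xi (fun k => om k w) by case: RX.
  have [Cxi|nC] := pselect (Cset xi); last first.
    have [tE kE] := hsol_trivial T0 H nC dt; subst t k.
    have -> : hval (X w) 0 0 = xi by case: H.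
    by apply: nbhd_cl_op nxi; lra.
  have Ct := hsol_Cset T0 H Cxi dt.
  apply: (in_arc_nbhd_op N0 (s := 1)) => //; first by rewrite mulr1; lra.
  by left; exists 0 => i; rewrite add0r; exact: Ct.
have /andP[rho0 rho1] := rho01.
have [n rn] : exists n, rho ^+ n < rho'.
  have /cvgrPdist_lt/(_ _ q0)[n _ hn] : (rho ^+ k) @[k --> \oo] --> (0 : R).
    by apply: cvg_expr; rewrite gtr0_norm.
  by exists n; have := hn n (leqnn n); rewrite /= sub0r normrN gtr0_norm // exprn_gt0.
have [K KP] := hsol_jump_count (e := e) r01 T0 (n%:R * Ts).
have Ts0 : 0 <= Ts by rewrite mulr_ge0 ?addr_ge0 // ltW.
have s0 : 0 <= n%:R * Ts by rewrite mulr_ge0.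
have K0 : 0 <= K%:R :> R by [].
(* At most [K] jumps occur up to time [n%:R * Ts], so [t + k] this large forces [t] beyond it. *)
exists (n%:R * Ts + K%:R + 1); split=> [|xi X _ RX]; first lra.
have [Cxi|nC] := pselect (Cset xi); last first.
  apply: prob_ge_setT => [|w t k dt]; first exact: ltW.
  have H : is_hsol e r T (X w) xi (fun k => om k w) by case: RX.
  by have [tE kE] := hsol_trivial T0 H nC dt; subst t k; rewrite addr0; lra.
have mL := late_measurable r01 T0 iid RX (n%:R * Ts).
exists (~` late X (n%:R * Ts)); split; first exact: measurableC.
- move=> w nl t k dt tk.
  have H : is_hsol e r T (X w) xi (fun k => om k w) by case: RX.
  apply: (hsol_after_nbhd_op H Cxi e0 s0 _ dt).
    by move=> k' ds; apply: contrapT => nA; apply: nl; exists k'.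
  rewrite ltNge; apply/negP => ts; have := KP _ _ _ _ _ H dt ts.
  by rewrite -(ler_nat R); lra.
- rewrite probability_setC // PrE // -EFinB lee_fin lerD2l lerN2.
  by apply: le_trans (late_rate n RX Cxi) (ltW rn).
Qed.

Lemma sync_triplet_rooted : sync_triplet P om e r T.
Proof.
have om_meas := iid_meas iid.
have CD xi : @Cset R N xi \/ Dset xi -> Cset xi by case=> // -[].
split=> [xi /CD Cxi|xi X /CD Cxi MX|]; last exact: UGASp_rooted.
- have [X [RX nt]] := rand_sol_exists (e := e) r01 T0 om_meas Cxi.
  by exists X; split => //; exact: aeW.
- apply: aeW => w; split; first exact: (max_rand_sol_complete r01 T0 om_meas Cxi MX).
  by case: MX => -[_ _ _ /(_ w) H] _; exact: (hsol_unif_nonzeno r01 T0 H N0).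
Qed.

(** Maximality enters through completeness: a solution that stops unsynchronized has infinite
    sync-time without being late. A complete one passes time [n%:R * Ts], where its state must lie
    outside [Async]. *)
Lemma sync_time_tail xi X n : Cset xi -> max_rand_sol om e r T X xi ->
  prob_le P [set w | ((n%:R * Ts)%:E < sync_time (X w))%E] (rho ^+ n).
Proof.
move=> Cxi MX; have [RX _] := MX.
have mL := late_measurable r01 T0 iid RX (n%:R * Ts).
have Ts0 : 0 <= Ts by rewrite mulr_ge0 ?addr_ge0 // ltW.
have s0 : 0 <= n%:R * Ts by rewrite mulr_ge0.
exists (late X (n%:R * Ts)); split => //; last by rewrite PrE // lee_fin (late_rate n RX Cxi).
move=> w /= st.
have H : is_hsol e r T (X w) xi (fun k => om k w) by case: RX.
have [K KP] := hsol_jump_count (e := e) r01 T0 (n%:R * Ts).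
have [t [k [dt tk]]] := max_rand_sol_complete r01 T0 (iid_meas iid) Cxi MX w (n%:R * Ts + K%:R).
have st' : n%:R * Ts < t.
  rewrite ltNge; apply/negP => ts; have := KP _ _ _ _ _ H dt ts.
  by rewrite -(ler_nat R); lra.
have [|k' ds] := hsol_dom_at H dt (s := n%:R * Ts); first by rewrite s0 ltW.
exists k'; split => // A; move: st; rewrite ltNge => /negP; apply.
by apply: ereal_inf_lbound; exists (n%:R * Ts) => //; exists k'.
Qed.

End Synchronization.

Theorem theorem3 (R : realType) (d : measure_display) (Omega : measurableType d)
  (P : probability Omega R) (N : nat) (T p : R) (r : 'I_N -> R)
  (e : rel 'I_N) (om : nat -> Omega -> edges) :
  (0 < N)%N -> 0 < T -> 0 < p < 1 -> (forall i, 0 < r i < 1) ->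
  simple_digraph e -> rooted e ->
  iid_law P om e p ->
  let rmin := \big[Num.min/1]_(i < N) r i in
  let lstar := (N * (Num.truncn (rmin^-1) + 1))%N in
  let Tstar := ((dep e * lstar)%:R + 1) * T in
  let rho := 1 - (p * (1 - p) ^+ (dep e).-1) ^+ (N * lstar) in
  sync_triplet P om e r T /\ 0 < rho < 1 /\
  forall (xi : state) (X : Omega -> harc), Cset xi ->
    max_rand_sol om e r T X xi ->
    forall n : nat, (0 < n)%N ->
      prob_le P [set w | ((n%:R * Tstar)%:E < sync_time (X w))%E] (rho ^+ n).
Proof.
move=> N0 T0 p01 r01 _ re iid rmin lstar Tstar rho.
have rmin0 : 0 < rmin by rewrite lt_bigmin // => i _; case/andP: (r01 i).
have rmin1 : rmin <= 1 by exact: bigmin_le_id.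
(* [rmin <= 1] makes the integer part of its inverse at least 1. *)
have lN : (2 * N <= lstar)%N.
  rewrite mulnC leq_mul2l; apply/orP; right; rewrite addn1 ltnS.
  by rewrite truncn_ge_nat ?invr_ge0 ?(ltW rmin0) // invf_ge1.
split; first exact: (sync_triplet_rooted N0 r01 T0 p01 re iid lN).
split; first by apply: rate_bounds => //; apply: leq_trans lN; rewrite muln_gt0.
by move=> xi X Cxi MX n _; exact: (sync_time_tail N0 r01 T0 p01 re iid lN).
Qed.
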